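(* Let $n,r,s$ be such that $G(n,r,s)$ is a graph with at least one edge and $(r-s)(n-1)\ge r(n-r)$. Then $$q^*(G(n,r,s))\le\frac{|sn-r^2|}{r(n-r)}.$$
   Context: For integers $n>r>s\ge 0$, the Johnson graph $G(n,r,s)$ has as vertices all vectors $v\in\{0,1\}^n$ with exactly $r$ ones; two vertices are joined by an edge if and only if their inner product equals $s$. Modularity: for a graph $G$ with $e(G)\geq 1$ edges and a partition $\mathcal{A}$ of its vertex set, $q(\mathcal{A})=\sum_{A\in\mathcal{A}}\frac{e(A)}{e(G)}-\sum_{A\in\mathcal{A}}\frac{(\sum_{v\in A}\deg(v))^2}{4e(G)^2}$, where $e(A)$ is the number of edges of $G$ with both endpoints in $A$. The modularity of $G$ is $q^*(G)=\max_{\mathcal{A}}q(\mathcal{A})$, over all partitions of the vertex set. *)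

(* Defs.v *)
From mathcomp Require Import all_boot all_order all_algebra.
Set Implicit Arguments.
Unset Strict Implicit.
Unset Printing Implicit Defensive.
Import Order.TTheory GRing.Theory Num.Theory.
Local Open Scope ring_scope.

(* Here [e] is the adjacency relation of a graph on [T], assumed symmetric and
   irreflexive; edges are unordered pairs, represented as sets [set x; y]. *)
Section Modularity.
Variables (T : finType) (e : rel T).

Definition edges : {set {set T}} := [set [set p.1; p.2] | p : T * T & e p.1 p.2].

Definition num_edges_in (A : {set T}) : nat := #|[set E in edges | E \subset A]|.

Definition num_edges : nat := #|edges|.

Definition degree (v : T) : nat := #|[set w | e v w]|.

Definition partition_modularity (P : {set {set T}}) : rat :=
  \sum_(A in P) ((num_edges_in A)%:R / num_edges%:R)
  - \sum_(A in P) ((\sum_(v in A) degree v)%N%:R ^+ 2 / (4 * num_edges%:R ^+ 2)).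

(* The base point of the maximum is the value at the one-block partition, which
   is a partition as soon as [T] is nonempty. *)
Definition modularity : rat :=
  \big[Num.max/partition_modularity [set [set: T]]]_(P : {set {set T}} |
      partition P [set: T]) partition_modularity P.

Lemma modularity_ge (P : {set {set T}}) :
  partition P [set: T] -> partition_modularity P <= modularity.
Proof. by move=> pP; apply: le_bigmax_cond. Qed.

Lemma modularity_attained : (0 < num_edges)%N ->
  exists2 P, partition P [set: T] & modularity = partition_modularity P.
Proof.
case/card_gt0P=> _ /imsetP[[x y] _ _].
apply: (big_ind (fun q => exists2 P, partition P [set: T]
                          & q = partition_modularity P)).
- exists [set [set: T]] => //; apply/and3P; split.
  + by rewrite /cover big_set1.
  + by apply/trivIsetP=> A B /set1P-> /set1P->; rewrite eqxx.
  + by rewrite inE eq_sym; apply/set0Pn; exists x; rewrite inE.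
- by move=> a b [P pP ->] [Q pQ ->]; rewrite maxEle; case: ifP => _;
    [exists Q | exists P].
- by move=> P pP; exists P.
Qed.

End Modularity.

Section Johnson.
Variables n r s : nat.

Definition johnson_vertex : Type :=
  {v : {ffun 'I_n -> bool} | (\sum_(i < n) v i)%N == r}.

Definition inner_product (v w : {ffun 'I_n -> bool}) : nat :=
  (\sum_(i < n) v i * w i)%N.

Definition johnson : rel johnson_vertex :=
  fun v w => inner_product (val v) (val w) == s.

Lemma johnson_sym : symmetric johnson.
Proof.
by move=> v w; rewrite /johnson /inner_product; under eq_bigr do rewrite mulnC.
Qed.

Lemma johnson_irrefl : (s < r)%N -> irreflexive johnson.
Proof.
move=> lt_sr v; rewrite /johnson /inner_product.
under eq_bigr do rewrite mulnb andbb.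
by rewrite (eqP (valP v)) gtn_eqF.
Qed.

End Johnson.

(* Main.v *)
(** For a [d]-regular graph whose adjacency matrix has all its eigenvalues on the
    orthogonal of the constants at most [lam >= 0], the modularity is at most
    [lam / d].  Put [m = n - r], [t = r - s]; complementing the vertices we may
    take [r <= m].  The functions [v |-> \sum_(S \subset v, #|S| = j) g S] with
    [g] harmonic span all functions on the [r]-subsets and are eigenfunctions,
    with eigenvalue [d Q_j], where [Q_0 = 1] and, for [x = t/r] and [y = t/m],
      [Q_(j+1)(r, m, t) = (1-x)(1-y) Q_j(r-1, m-1, t) - xy Q_j(r-1, m-1, t-1)].
    Here [Q_1 = -q] with [q = x + y - 1], and [q] is the right-hand side of the
    theorem; the hypothesis says that [q >= 1 / (n-1)].  So it is enough that
    [Q_j <= q] for [j >= 2].  Now [Q_2 = q^2 - V] with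
    [V = x(1-x)/(r-1) + y(1-y)/(m-1)], and the recursion preserves the bound
    [|Q_j| <= q^2 + V], for every [t].  One more step of the recursion, applied
    to this bound, gives [Q_j <= q] for [j >= 3] and [t < r], with a unique
    exception [(r, m, t) = (3, 4, 2)], where [Q_3 = q]; for [t = r] the trivial
    bound [|Q_(j-1)| <= 1] suffices. *)

Require Import Defs.
From mathcomp Require Import all_boot all_order all_algebra.
From mathcomp Require Import ring lra zify.
Set Implicit Arguments.
Unset Strict Implicit.
Unset Printing Implicit Defensive.
Import Order.TTheory GRing.Theory Num.Theory.
Local Open Scope ring_scope.

(** * Normalised eigenvalues *)

Section Hahn.
Variable R : realFieldType.
Implicit Types r m t : R.

(* If [X] and [Y] are uniform [t]-subsets of sets of sizes [r] and [m] that share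
   [j] labels [1, .., j], this is the expectation of the product over [i <= j] of
   [1 - [i \in X] - [i \in Y]]; the recursion conditions on one label. *)
Fixpoint hahn (j : nat) r m t : R :=
  if j is i.+1 then
    (1 - t / r) * (1 - t / m) * hahn i (r - 1) (m - 1) t
    - t / r * (t / m) * hahn i (r - 1) (m - 1) (t - 1)
  else 1.

Lemma hahnS j r m t : hahn j.+1 r m t =
  (1 - t / r) * (1 - t / m) * hahn j (r - 1) (m - 1) t
  - t / r * (t / m) * hahn j (r - 1) (m - 1) (t - 1).
Proof. by []. Qed.

Definition hahn_excess r m t : R := t / r + t / m - 1.

Definition hahn_var r m t : R :=
  t / r * (1 - t / r) / (r - 1) + t / m * (1 - t / m) / (m - 1).

Definition hahn_bound r m t : R := hahn_excess r m t ^+ 2 + hahn_var r m t.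

(* What the triangle inequality gives for [hahn j.+1] when [hahn_bound] bounds
   [hahn j] at the smaller parameters. *)
Definition hahn_step r m t : R :=
  (1 - t / r) * (1 - t / m) * hahn_bound (r - 1) (m - 1) t
  + t / r * (t / m) * hahn_bound (r - 1) (m - 1) (t - 1).

Lemma hahn1 r m t : r != 0 -> m != 0 -> hahn 1 r m t = - hahn_excess r m t.
Proof. by move=> r0 m0; rewrite /= /hahn_excess; field; rewrite r0 m0. Qed.

Lemma hahn2 r m t : r != 0 -> m != 0 -> r - 1 != 0 -> m - 1 != 0 ->
  hahn 2 r m t = hahn_excess r m t ^+ 2 - hahn_var r m t.
Proof.
move=> r0 m0 r1 m1; rewrite /= /hahn_excess /hahn_var; field.
by rewrite r0 m0 r1 m1.
Qed.

(** The cofactor of [x (1 - x) / (r - 1)] in the saving [hahn_bound - hahn_step], cross term apart;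
    exchanging [r] and [m] gives that of the other variance term. *)
Definition gap_bracket r m t : R :=
  (r - 3) / (2 * (r - 1)) + (2 * t / m - 1) ^+ 2
  + (2 * t / r - 1) * (2 * t / m - 1) * (1 / 2 - r / ((r - 1) * (r - 2))).

Lemma hahn_bound_sub_hahn_step r m t :
  r != 0 -> m != 0 -> r - 1 != 0 -> m - 1 != 0 -> r - 2 != 0 -> m - 2 != 0 ->
  let x := t / r in let y := t / m in
  hahn_bound r m t - hahn_step r m t =
  (x + y - 2 * x * y) * hahn_excess r m t ^+ 2
  + x * (1 - x) / (r - 1) * gap_bracket r m t
  + y * (1 - y) / (m - 1) * gap_bracket m r t
  - 4 * (x * (1 - x) / (r - 1)) * (y * (1 - y) / (m - 1)).
Proof.
move=> r0 m0 r1 m1 r2 m2 x y; rewrite /x /y /hahn_step /hahn_bound.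
rewrite /hahn_excess /hahn_var /gap_bracket; field.
by rewrite m1 m0 r1 r0 m2 r2.
Qed.

(** The last factor of [gap_bracket] serves as [c]: it is nonnegative from [r = 5] on, but negative
    at [r = 4]. *)
Lemma gap_bracketP r m t : 5 <= r ->
  exists2 c, 0 <= c <= 1 / 2 &
    gap_bracket r m t = 1 / 2 - (r - 1)^-1 + (2 * t / m - 1) ^+ 2
                        + (2 * t / r - 1) * (2 * t / m - 1) * c.
Proof.
move=> r5; exists (1 / 2 - r / ((r - 1) * (r - 2))).
  have d0 : 0 < (r - 1) * (r - 2) by apply: mulr_gt0; lra.
  have : 0 <= r / ((r - 1) * (r - 2)) by apply: divr_ge0; lra.
  have : r / ((r - 1) * (r - 2)) <= 1 / 2 by rewrite ler_pdivrMr //; nra.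
  by move=> ? ?; apply/andP; split; lra.
rewrite /gap_bracket; congr (_ + _ + _).
have r1 : r - 1 != 0 by rewrite gt_eqF; lra.
by field.
Qed.

Lemma ratio_bounds r t : 0 < r -> 0 <= t <= r -> 0 <= t / r <= 1.
Proof.
by move=> r0 /andP[t0 tr]; rewrite divr_ge0 ?ler_pdivrMr ?mul1r ?(ltW r0).
Qed.

Lemma invr_pred_bounds k r : 0 < k -> k + 1 <= r -> 0 < (r - 1)^-1 <= k^-1.
Proof.
move=> k0 kr; have r1 : 0 < r - 1 by lra.
by rewrite invr_gt0 r1 lef_pV2 ?posrE //; lra.
Qed.

Lemma mul_onem_bounds (a : R) : 0 <= a <= 1 -> 0 <= a * (1 - a) <= 1 / 4.
Proof.
move=> /andP[a0 a1]; rewrite mulr_ge0 ?subr_ge0 //=.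
by have := sqr_ge0 (2 * a - 1); lra.
Qed.

(** Completing the square in [2b - 1] loses at most [1/16], while [k] and the last term take at most
    [1/4] and [1/8] from the leading [1/2]. *)
Lemma step_bracket_ge0 (a b e k k' : R) : 0 <= a <= 1 -> 0 <= b <= 1 ->
  0 <= e <= 1 / 2 -> k <= 4^-1 -> 0 <= k' <= 4^-1 ->
  0 <= 1 / 2 - k + (2 * b - 1) ^+ 2 + (2 * a - 1) * (2 * b - 1) * e
    - 2 * (b * (1 - b) * k').
Proof.
move=> /andP[a0 a1] /mul_onem_bounds/andP[b0 b1] /andP[e0 e1] k1 /andP[k'0 k'1].
have bk := ler_pM b0 k'0 b1 k'1.
have u2 : (2 * a - 1) ^+ 2 <= 1 by nra.
have e2 : e ^+ 2 <= 1 / 4 by nra.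
have ue := ler_pM (sqr_ge0 _) (sqr_ge0 _) u2 e2.
have sq := sqr_ge0 ((2 * b - 1) + (2 * a - 1) * e / 2).
suff : 1 / 2 - 1 / 4 + (2 * b - 1) ^+ 2 + (2 * a - 1) * (2 * b - 1) * e
   - 1 / 8 >= 0 by lra.
lra.
Qed.

Lemma gap_ge0 (x y p p' c c' : R) : 0 <= x <= 1 -> 0 <= y <= 1 ->
  0 <= c <= 1 / 2 -> 0 <= c' <= 1 / 2 -> 0 <= p <= 4^-1 -> 0 <= p' <= 4^-1 ->
  0 <= (x + y - 2 * x * y) * (x + y - 1) ^+ 2
    + x * (1 - x) * p * (1 / 2 - p + (2 * y - 1) ^+ 2
                         + (2 * x - 1) * (2 * y - 1) * c)
    + y * (1 - y) * p' * (1 / 2 - p' + (2 * x - 1) ^+ 2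
                         + (2 * y - 1) * (2 * x - 1) * c')
    - 4 * (x * (1 - x) * p) * (y * (1 - y) * p').
Proof.
move=> x01 y01 c01 c'01 p01 p'01.
have /andP[p0 p1] := p01; have /andP[p'0 p'1] := p'01.
(* The cross term is split evenly, one half going to each bracket. *)
have b1 := step_bracket_ge0 x01 y01 c01 p1 p'01.
have b2 := step_bracket_ge0 y01 x01 c'01 p'1 p01.
have /andP[x2 _] := mul_onem_bounds x01; have /andP[y2 _] := mul_onem_bounds y01.
have w0 : 0 <= x + y - 2 * x * y.
  have -> : x + y - 2 * x * y = x * (1 - y) + y * (1 - x) by ring.
  move: x01 y01 => /andP[? ?] /andP[? ?].
  by rewrite addr_ge0 // mulr_ge0 // subr_ge0.
have := addr_ge0 (mulr_ge0 w0 (sqr_ge0 (x + y - 1)))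
  (addr_ge0 (mulr_ge0 (mulr_ge0 x2 p0) b1) (mulr_ge0 (mulr_ge0 y2 p'0) b2)).
clear; congr (0 <= _); ring.
Qed.

Lemma hahn_step_le_hahn_bound_large r m t :
  5 <= r -> 5 <= m -> 0 <= t <= r -> t <= m ->
  hahn_step r m t <= hahn_bound r m t.
Proof.
move=> r5 m5 /andP[t0 tr] tm.
have neq (k a : R) : k < 5 -> 5 <= a -> a - k != 0.
  by move=> k5 a5; rewrite gt_eqF // subr_gt0 (lt_le_trans k5).
have r0 : 0 < r by apply: lt_le_trans r5; rewrite ltr0n.
have m0 : 0 < m by apply: lt_le_trans m5; rewrite ltr0n.
have lt5 (k : nat) : (k < 5)%N -> k%:R < 5 :> R by rewrite ltr_nat.
rewrite -subr_ge0 hahn_bound_sub_hahn_step ?neq ?gt_eqF ?ltr1n ?lt5 //.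
have [c c01 ->] := gap_bracketP m t r5.
have [c' c'01 ->] := gap_bracketP r t m5.
have x01 : 0 <= t / r <= 1 by apply: ratio_bounds; rewrite ?t0.
have y01 : 0 <= t / m <= 1 by apply: ratio_bounds; rewrite ?t0.
have p01 : 0 <= (r - 1)^-1 <= 4^-1.
  have /andP[/ltW-> ->] //: 0 < (r - 1)^-1 <= 4^-1.
  by apply: invr_pred_bounds => //; lra.
have p'01 : 0 <= (m - 1)^-1 <= 4^-1.
  have /andP[/ltW-> ->] // : 0 < (m - 1)^-1 <= 4^-1.
  by apply: invr_pred_bounds => //; lra.
rewrite /hahn_excess -!(mulrA 2 t).
exact: gap_ge0.
Qed.

(** With [u = 2a - 1], [v = 2b - 1] and [s = a + b - 1 = (u + v) / 2], one has [v^2 + u v g + s^2 /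
    2 = (1 - 2g) (v^2 + s^2 / 2) + g (v + s)^2 >= 0]. *)
Lemma gap_bracket_ge (a b k g : R) : 0 <= g <= 1 / 2 -> k <= 5^-1 ->
  3 / 10 - (a + b - 1) ^+ 2 / 2
    <= 1 / 2 - k + (2 * b - 1) ^+ 2 + (2 * a - 1) * (2 * b - 1) * g.
Proof.
move=> /andP[g0 g1] k1.
have g2 : 0 <= 1 - 2 * g by lra.
have h1 := mulr_ge0 g2 (addr_ge0 (sqr_ge0 (2 * b - 1))
              (divr_ge0 (sqr_ge0 (a + b - 1)) (ler0n R 2))).
have h2 := mulr_ge0 g0 (sqr_ge0 (2 * b - 1 + (a + b - 1))).
lra.
Qed.

(* For small [q] the bound [q ^+ 2 + V] is too large by itself, and the saving
   [hahn_bound - hahn_step] is needed. *)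
Lemma gap_ge (x y p p' c c' q V : R) :
  0 <= x <= 1 -> 0 <= y <= 1 ->
  0 <= c <= 1 / 2 -> 0 <= c' <= 1 / 2 -> 0 <= p <= 5^-1 -> 0 <= p' <= 5^-1 ->
  q = x + y - 1 -> V = x * (1 - x) * p + y * (1 - y) * p' ->
  q ^+ 2 * (1 - q ^+ 2) / 2 + V * (1 / 5 - q ^+ 2 / 2) <=
    (x + y - 2 * x * y) * q ^+ 2
    + x * (1 - x) * p * (1 / 2 - p + (2 * y - 1) ^+ 2
                         + (2 * x - 1) * (2 * y - 1) * c)
    + y * (1 - y) * p' * (1 / 2 - p' + (2 * x - 1) ^+ 2
                         + (2 * y - 1) * (2 * x - 1) * c')
    - 4 * (x * (1 - x) * p) * (y * (1 - y) * p').
Proof.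
move=> x01 y01 c01 c'01 /andP[p0 p1] /andP[p'0 p'1] -> ->.
have b1 := gap_bracket_ge x y c01 p1.
have := gap_bracket_ge y x c'01 p'1; rewrite (addrC y x) => b2.
have /andP[x0 x1] := mul_onem_bounds x01.
have /andP[y0 y1] := mul_onem_bounds y01.
have al0 := mulr_ge0 x0 p0; have be0 := mulr_ge0 y0 p'0.
have al1 := ler_pM x0 p0 x1 p1; have be1 := ler_pM y0 p'0 y1 p'1.
have w : (1 - (x + y - 1) ^+ 2) / 2 <= x + y - 2 * x * y.
  by have := sqr_ge0 (x - y); clear; lra.
move/(ler_wpM2r (sqr_ge0 (x + y - 1))): w.
move/(ler_wpM2l al0): b1; move/(ler_wpM2l be0): b2.
(* Each variance term is at most [1/20], so the cross term costs at most a tenth of each; this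
   lowers the [3/10] of [gap_bracket_ge] to [1/5]. *)
move: (ler_wpM2l al0 be1) (ler_wpM2l be0 al1).
clear; move: (x * (1 - x) * p) (y * (1 - y) * p') => al be; lra.
Qed.

(** To first order in [q], the saving leaves at most [4/5 V], hence [4/5 q]; for [q <= 1/8] the
    higher powers fit into the remaining fifth. *)
Lemma step_le_excess_small (q V S D : R) : 0 <= q <= 1 / 8 -> 0 <= V <= (1 + q) * q ->
  q ^+ 2 * (1 - q ^+ 2) / 2 + V * (1 / 5 - q ^+ 2 / 2) <= D ->
  S = q ^+ 2 + V - D -> S <= q.
Proof.
move=> /andP[q0 q1] /andP[V0 V1] hD ->.
have q2 : q ^+ 2 <= 1 / 8 * q by rewrite expr2 ler_wpM2r.
have w0 : 0 <= 4 / 5 + q ^+ 2 / 2 by have := sqr_ge0 q; lra.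
have := ler_wpM2r w0 V1.
have q3 : q ^+ 3 <= 1 / 64 * q by rewrite exprS; nra.
have q4 : q ^+ 4 <= 1 / 512 * q by rewrite exprS; nra.
nra.
Qed.

Lemma step_le_excess_large (x y p p' e q V S : R) :
  0 <= x <= 1 -> 0 <= y <= 1 -> 0 <= p <= 5^-1 -> 0 <= p' <= 5^-1 ->
  e <= 11^-1 -> (1 - x) * p <= e -> (1 - y) * p' <= e ->
  q = x + y - 1 -> V = x * (1 - x) * p + y * (1 - y) * p' ->
  1 / 8 <= q -> S <= q ^+ 2 + V -> S <= q.
Proof.
move=> /andP[x0 x1] /andP[y0 y1] /andP[p0 p1] /andP[p'0 p'1] e1 xe ye.
move=> defq defV q8 hS.
have x'0 : 0 <= 1 - x by rewrite subr_ge0.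
have y'0 : 0 <= 1 - y by rewrite subr_ge0.
have V1 : V <= (1 + q) * 11^-1.
  have := ler_wpM2l x0 (le_trans xe e1); have := ler_wpM2l y0 (le_trans ye e1).
  by rewrite defV defq; clear; lra.
have V2 : V <= (1 - q) * 5^-1.
  have := ler_pM (mulr_ge0 x0 x'0) p0 (ler_piMl x'0 x1) p1.
  have := ler_pM (mulr_ge0 y0 y'0) p'0 (ler_piMl y'0 y1) p'1.
  by rewrite defV defq; clear; lra.
have q1 : q <= 1 by rewrite defq; clear - x1 y1; lra.
clear - V1 V2 hS q8 q1.
(* With [V2] the claim becomes [(1 - q) (q - 1/5) >= 0]; below [1/5] the bound [V1] takes over. *)
have [q5|/ltW q5] := lerP (1 / 5) q.
  have : 0 <= (1 - q) * (q - 1 / 5) by rewrite mulr_ge0 ?subr_ge0.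
  by lra.
have : 0 <= (q - 1 / 8) * (1 / 5 - q) by rewrite mulr_ge0 ?subr_ge0.
by lra.
Qed.

(** Put [n = r + m]. The last hypothesis is equivalent to each of [q >= 1/(n-1)],
    [(1-x)/(r-1) <= 1/(n-1)] and [(1-y)/(m-1) <= 1/(n-1)]. Hence [V <= (x + y)/(n-1) <= (1 + q) q],
    as the case of small [q] requires. The [11] of [step_le_excess_large] is [6 + 6 - 1]. *)
Lemma hahn_step_le_hahn_excess_large r m t :
  6 <= r -> 6 <= m -> 0 <= t <= r -> t <= m ->
  r * m <= t * (r + m - 1) -> hahn_step r m t <= hahn_excess r m t.
Proof.
move=> r6 m6 /andP[t0 tr] tm cond.
have r5 : 5 <= r by lra.
have m5 : 5 <= m by lra.
have neq (k a : R) : k < 5 -> 5 <= a -> a - k != 0.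
  by move=> k5 a5; rewrite gt_eqF // subr_gt0 (lt_le_trans k5).
have r0 : 0 < r by apply: lt_le_trans r5; rewrite ltr0n.
have m0 : 0 < m by apply: lt_le_trans m5; rewrite ltr0n.
have n0 : 0 < r + m - 1 by clear - r5 m5; lra.
have r1 : 0 < r - 1 by clear - r5; lra.
have m1 : 0 < m - 1 by clear - m5; lra.
have lt5 (k : nat) : (k < 5)%N -> k%:R < 5 :> R by rewrite ltr_nat.
have x01 : 0 <= t / r <= 1 by apply: ratio_bounds; rewrite ?t0.
have y01 : 0 <= t / m <= 1 by apply: ratio_bounds; rewrite ?t0.
have p01 : 0 <= (r - 1)^-1 <= 5^-1.
  have /andP[/ltW-> ->] //: 0 < (r - 1)^-1 <= 5^-1.
  by apply: invr_pred_bounds => //; lra.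
have p'01 : 0 <= (m - 1)^-1 <= 5^-1.
  have /andP[/ltW-> ->] //: 0 < (m - 1)^-1 <= 5^-1.
  by apply: invr_pred_bounds => //; lra.
have e1 : (r + m - 1)^-1 <= 11^-1.
  by rewrite lef_pV2 ?posrE //; clear - r6 m6; lra.
have ge0 := (ltW r0, ltW m0, ltW r1, ltW m1, ltW n0).
have cond0 : 0 <= t * (r + m - 1) - r * m by rewrite subr_ge0.
have qe : (r + m - 1)^-1 <= hahn_excess r m t.
  rewrite -subr_ge0 /hahn_excess.
  have -> : t / r + t / m - 1 - (r + m - 1)^-1
    = (t * (r + m - 1) - r * m) * (r + m) / (r * m * (r + m - 1)).
    by field; rewrite !gt_eqF.
  by rewrite divr_ge0 ?mulr_ge0 ?cond0 ?ge0 ?addr_ge0 ?ge0 //.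
have xe : (1 - t / r) * (r - 1)^-1 <= (r + m - 1)^-1.
  rewrite -subr_ge0.
  have -> : (r + m - 1)^-1 - (1 - t / r) * (r - 1)^-1
    = (t * (r + m - 1) - r * m) / (r * (r - 1) * (r + m - 1)).
    by field; rewrite !gt_eqF.
  by rewrite divr_ge0 ?mulr_ge0 ?ge0 //.
have ye : (1 - t / m) * (m - 1)^-1 <= (r + m - 1)^-1.
  rewrite -subr_ge0.
  have -> : (r + m - 1)^-1 - (1 - t / m) * (m - 1)^-1
    = (t * (r + m - 1) - r * m) / (m * (m - 1) * (r + m - 1)).
    by field; rewrite !gt_eqF.
  by rewrite divr_ge0 ?mulr_ge0 ?ge0 //.
have [q8|/ltW q8] := lerP (1 / 8) (hahn_excess r m t).
  apply: (@step_le_excess_large _ _ _ _ _ (hahn_excess r m t) (hahn_var r m t) _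
    x01 y01 p01 p'01 e1 xe ye) => //.
  by apply: hahn_step_le_hahn_bound_large; rewrite ?t0.
have := @hahn_bound_sub_hahn_step r m t; rewrite !neq ?gt_eqF ?ltr1n ?lt5 //=.
move=> /(_ isT isT isT isT isT isT).
have [c c01 ->] := gap_bracketP m t r5.
have [c' c'01 ->] := gap_bracketP r t m5.
rewrite -!(mulrA 2 t) => defS.
have q0 : 0 <= hahn_excess r m t.
  by apply: le_trans qe; rewrite ltW // invr_gt0.
apply: (@step_le_excess_small _ (hahn_var r m t) _ (hahn_bound r m t - hahn_step r m t)).
- by rewrite q0.
- have /andP[x0 x1] := x01; have /andP[y0 y1] := y01.
  have /andP[p0 _] := p01; have /andP[p'0 _] := p'01.
  have hx := ler_wpM2l x0 (le_trans xe qe).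
  have hy := ler_wpM2l y0 (le_trans ye qe).
  have /andP[xx _] := mul_onem_bounds x01.
  have /andP[yy _] := mul_onem_bounds y01.
  rewrite mulrA in hx; rewrite mulrA in hy.
  have -> : (1 + hahn_excess r m t) * hahn_excess r m t
     = t / r * hahn_excess r m t + t / m * hahn_excess r m t.
    by rewrite /hahn_excess; ring.
  by rewrite /hahn_var (addr_ge0 (mulr_ge0 xx p0) (mulr_ge0 yy p'0)) lerD.
- rewrite defS; exact: gap_ge.
- by rewrite /hahn_bound; ring.
Qed.

(** * Small [r]: explicit rational functions *)

Lemma frac_ge0 (a N d : R) : 0 < d -> a = N / d -> 0 <= N -> 0 <= a.
Proof. by move=> d0 -> N0; rewrite divr_ge0 // ltW. Qed.

(* At [t = 2] the numerator is negative for [0 < K < 1]: that [m] is an integer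
   matters. *)
Lemma hahn_step_le_hahn_bound_3 (k t : nat) : (t <= 3)%N ->
  hahn_step 3 (3 + k%:R) t%:R <= hahn_bound 3 (3 + k%:R) t%:R :> R.
Proof.
move=> t3; rewrite -subr_ge0.
have k0 : 0 <= k%:R :> R by rewrite ler0n.
have k1 : 0 <= k%:R * (k%:R - 1) :> R.
  by case: (k) => [|i]; rewrite ?mul0r // mulr_ge0 // subr_ge0 ler1n.
move: (k%:R) k0 k1 => K k0 k1.
have kn i : 0 <= K ^+ i by rewrite exprn_ge0.
have M0 : 0 < 3 + K by lra.
have M1 : 0 < 3 + K - 1 by lra.
have M2 : 0 < 3 + K - 2 by lra.
have M11 : 0 < 3 + K - 1 - 1 by lra.
have den (c : R) : 0 < c ->
    0 < c * ((3 + K) ^+ 3 * (3 + K - 1) ^+ 2 * (3 + K - 2)).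
  by move=> c0; rewrite !mulr_gt0 ?exprn_gt0.
rewrite /hahn_step /hahn_bound /hahn_excess /hahn_var.
case: t t3 => [|[|[|[|//]]]] _.
- apply: (@frac_ge0 _
   (0)
    _ (den 1 ltr01)).
    by field; rewrite !gt_eqF.
  by move: k0 (kn 2) (kn 3) (kn 4) (kn 5) (kn 6); clear; lra.
- apply: (@frac_ge0 _
   (108 * K + 258 * K ^+ 2 + 230 * K ^+ 3 + 100 * K ^+ 4 +
    22 * K ^+ 5 + 2 * K ^+ 6)
    _ (den 9 _)); first by rewrite ltr0n.
    by field; rewrite !gt_eqF.
  by move: k0 (kn 2) (kn 3) (kn 4) (kn 5) (kn 6); clear; lra.
- apply: (@frac_ge0 _
   (2 * (K * (K * (K - 1))) * ((K + 1) * (K + 2) * (K + 3)))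
    _ (den 9 _)); first by rewrite ltr0n.
    by field; rewrite !gt_eqF.
  apply: (mulr_ge0 (mulr_ge0 (ler0n R 2) (mulr_ge0 k0 k1))).
  by rewrite !mulr_ge0 ?addr_ge0.
- apply: (@frac_ge0 _
   (36 * K + 120 * K ^+ 2 + 72 * K ^+ 3 + 12 * K ^+ 4)
    _ (den 1 ltr01)).
    by field; rewrite !gt_eqF.
  by move: k0 (kn 2) (kn 3) (kn 4) (kn 5) (kn 6); clear; lra.
Qed.

(** [gap_bracketP] starts at [5]; here the substitution [m = 4 + K] leaves numerators without
    negative coefficients. *)
Lemma hahn_step_le_hahn_bound_4 (k t : nat) : (t <= 4)%N ->
  hahn_step 4 (4 + k%:R) t%:R <= hahn_bound 4 (4 + k%:R) t%:R :> R.
Proof.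
move=> t4; rewrite -subr_ge0.
have k0 : 0 <= k%:R :> R by rewrite ler0n.
move: (k%:R) k0 => K k0.
have kn i : 0 <= K ^+ i by rewrite exprn_ge0.
have M0 : 0 < 4 + K by lra.
have M1 : 0 < 4 + K - 1 by lra.
have M2 : 0 < 4 + K - 2 by lra.
have M11 : 0 < 4 + K - 1 - 1 by lra.
have den (c : R) : 0 < c ->
    0 < c * ((4 + K) ^+ 3 * (4 + K - 1) ^+ 2 * (4 + K - 2)).
  by move=> c0; rewrite !mulr_gt0 ?exprn_gt0.
rewrite /hahn_step /hahn_bound /hahn_excess /hahn_var.
case: t t4 => [|[|[|[|[|//]]]]] _.
- apply: (@frac_ge0 _
   (0)
    _ (den 1 ltr01)).
    by field; rewrite !gt_eqF.
  by move: k0 (kn 2) (kn 3) (kn 4) (kn 5) (kn 6); clear; lra.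
- apply: (@frac_ge0 _
   (3456 + 7488 * K + 6480 * K ^+ 2 + 2890 * K ^+ 3 +
    709 * K ^+ 4 + 92 * K ^+ 5 + 5 * K ^+ 6)
    _ (den 24 _)); first by rewrite ltr0n.
    by field; rewrite !gt_eqF.
  by move: k0 (kn 2) (kn 3) (kn 4) (kn 5) (kn 6); clear; lra.
- apply: (@frac_ge0 _
   (144 * K + 340 * K ^+ 2 + 296 * K ^+ 3 + 123 * K ^+ 4 +
    25 * K ^+ 5 + 2 * K ^+ 6)
    _ (den 9 _)); first by rewrite ltr0n.
    by field; rewrite !gt_eqF.
  by move: k0 (kn 2) (kn 3) (kn 4) (kn 5) (kn 6); clear; lra.
- apply: (@frac_ge0 _
   (1152 + 1728 * K + 912 * K ^+ 2 + 158 * K ^+ 3 +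
    5 * K ^+ 4 + 4 * K ^+ 5 + K ^+ 6)
    _ (den 8 _)); first by rewrite ltr0n.
    by field; rewrite !gt_eqF.
  by move: k0 (kn 2) (kn 3) (kn 4) (kn 5) (kn 6); clear; lra.
- apply: (@frac_ge0 _
   (384 * K + 496 * K ^+ 2 + 180 * K ^+ 3 + 20 * K ^+ 4)
    _ (den 1 ltr01)).
    by field; rewrite !gt_eqF.
  by move: k0 (kn 2) (kn 3) (kn 4) (kn 5) (kn 6); clear; lra.
Qed.

Lemma predrS (n : nat) : n.+1%:R - 1 = n%:R :> R.
Proof. by rewrite -natr1 addrK. Qed.

Lemma hahn_step_le_hahn_bound (r m t : nat) : (3 <= r <= m)%N -> (t <= r)%N ->
  hahn_step r%:R m%:R t%:R <= hahn_bound r%:R m%:R t%:R :> R.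
Proof.
move=> /andP[r3 rm] tr.
have [r5|] := leqP 5 r.
  apply: hahn_step_le_hahn_bound_large; rewrite ?ler0n ?ler_nat //.
    exact: leq_trans rm.
  exact: leq_trans rm.
move=> r5; rewrite -(subnKC rm) natrD.
case: r r3 r5 tr {rm} => [|[|[|[|[|//]]]]] // _ _ tr.
  exact: hahn_step_le_hahn_bound_3.
exact: hahn_step_le_hahn_bound_4.
Qed.

(** * Bounds on [hahn] by induction on [j] *)

Lemma coef_hahn_ge0 (r m t : nat) : (t <= r)%N -> (r <= m)%N ->
  (0 <= t%:R / r%:R * (t%:R / m%:R) :> R) *
  (0 <= (1 - t%:R / r%:R) * (1 - t%:R / m%:R) :> R).
Proof.
move=> tr rm; have tm := leq_trans tr rm.
have le1 (a : nat) : (t <= a)%N -> 0 <= 1 - t%:R / a%:R :> R.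
  case: a => [|a] ta; first by rewrite invr0 mulr0 subr0.
  by rewrite subr_ge0 ler_pdivrMr ?ltr0n // mul1r ler_nat.
by split; rewrite mulr_ge0 ?divr_ge0 ?ler0n // le1.
Qed.

(* The first coefficient of the recursion vanishes at [t = r] and the second
   at [t = 0], so only genuine parameters of the smaller scheme matter. *)
Lemma norm_hahnS_le (j r m t : nat) (B : R -> R -> R -> R) :
  (0 < r <= m)%N -> (t <= r)%N ->
  (forall t' : nat, (t' <= r.-1)%N ->
     `|hahn j r.-1%:R m.-1%:R t'%:R| <= B r.-1%:R m.-1%:R t'%:R) ->
  `|hahn j.+1 r%:R m%:R t%:R : R|
    <= (1 - t%:R / r%:R) * (1 - t%:R / m%:R) * B (r%:R - 1) (m%:R - 1) t%:R
       + t%:R / r%:R * (t%:R / m%:R) * B (r%:R - 1) (m%:R - 1) (t%:R - 1).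
Proof.
case: r => // r; case: m => // m /andP[_ rm] tr /= leB.
have [c1 c2] := coef_hahn_ge0 tr rm.
rewrite !predrS; apply: le_trans (ler_normB _ _) _; apply: lerD.
  rewrite normrM ger0_norm //; move: tr; rewrite leq_eqVlt => /predU1P[->|tr].
    by rewrite divff ?pnatr_eq0 // subrr !mul0r.
  by apply: ler_wpM2l => //; apply: leB.
rewrite normrM ger0_norm //; case: t tr c1 {c2} => [|t] tr c1.
  by rewrite !mul0r.
by rewrite predrS; apply: ler_wpM2l => //; apply: leB.
Qed.

Lemma ratio_natr (a t : nat) : (0 < a)%N -> (t <= a)%N ->
  (0 <= t%:R / a%:R :> R) && (t%:R / a%:R <= 1 :> R).
Proof. by move=> a0 ta; apply: ratio_bounds; rewrite ?ltr0n ?ler0n ?ler_nat. Qed.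

(** In absolute value the coefficients of the recursion add up to [(1 - x)(1 - y) + x y <= 1]. *)
Lemma norm_hahn_le1 (j r m t : nat) : (j <= r <= m)%N -> (t <= r)%N ->
  `|hahn j r%:R m%:R t%:R : R| <= 1.
Proof.
elim: j r m t => [|j IHj] r m t; first by rewrite normr1.
case/andP=> jr rm tr.
have rm0 : (0 < r <= m)%N by rewrite (leq_ltn_trans _ jr).
apply: le_trans (@norm_hahnS_le j r m t (fun _ _ _ => 1) rm0 tr _) _.
  by move=> t' tr'; apply: IHj => //; lia.
have x01 : (0 <= t%:R / r%:R :> R) && (t%:R / r%:R <= 1 :> R).
  by apply: ratio_natr; lia.
have y01 : (0 <= t%:R / m%:R :> R) && (t%:R / m%:R <= 1 :> R).
  by apply: ratio_natr; lia.
move: (t%:R / r%:R) (t%:R / m%:R) x01 y01 => x y /andP[x0 x1] /andP[y0 y1].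
rewrite !mulr1; nra.
Qed.

Lemma hahn_var_ge0 (r m t : nat) : (1 < r <= m)%N -> (t <= r)%N ->
  0 <= hahn_var r%:R m%:R t%:R :> R.
Proof.
move=> /andP[r1 rm] tr.
have var_ge0 a : (1 < a)%N -> (t <= a)%N ->
    0 <= t%:R / a%:R * (1 - t%:R / a%:R) / (a%:R - 1) :> R.
  case: a => // a a1 ta; rewrite predrS divr_ge0 ?ler0n //.
  by have /mul_onem_bounds/andP[] := ratio_natr (ltnW a1) ta.
by rewrite addr_ge0 // var_ge0 // ?(leq_trans r1) // (leq_trans tr).
Qed.

(** The induction starts at [j = 2], where [hahn2] gives the bound directly; at [j = 1] it would
    fail, since [|q|] can exceed [q^2 + V]. *)
Lemma norm_hahn_le (j r m t : nat) : (2 <= j <= r)%N -> (r <= m)%N ->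
  (t <= r)%N -> `|hahn j r%:R m%:R t%:R : R| <= hahn_bound r%:R m%:R t%:R.
Proof.
elim: j r m t => [//|j IHj] r m t /andP[j1 jr] rm tr.
have rm0 : (0 < r <= m)%N by rewrite (leq_ltn_trans _ jr).
move: j1; rewrite ltnS leq_eqVlt => /predU1P[j1|j1].
  rewrite -j1 in jr *; case: r jr rm tr {rm0 IHj} => [|[|r]] // _.
  case: m => [|[|m]] // rm tr.
  rewrite hahn2 ?predrS ?pnatr_eq0 //; apply: le_trans (ler_normB _ _) _.
  by rewrite ger0_norm ?sqr_ge0 // lerD2l ger0_norm // hahn_var_ge0.
apply: le_trans (norm_hahnS_le rm0 tr _) (hahn_step_le_hahn_bound _ tr);
  last by lia.
by move=> t' tr'; apply: IHj => //; lia.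
Qed.

(** At [t = r] the recursion keeps only its second term, whose coefficient [r / m] is [hahn_excess]
    itself. *)
Lemma hahn_diag_le (j r m : nat) : (1 < j <= r)%N -> (r <= m)%N ->
  hahn j r%:R m%:R r%:R <= hahn_excess r%:R m%:R r%:R :> R.
Proof.
case: j => // j /andP[_ jr] rm.
have rm0 : (0 < r <= m)%N by rewrite (leq_ltn_trans _ jr).
apply: le_trans (ler_norm _) _.
apply: le_trans (@norm_hahnS_le j r m r (fun _ _ _ => 1) rm0 _ _) _ => //.
  by move=> t' tr'; apply: norm_hahn_le1 => //; lia.
have r0 : r%:R != 0 :> R by rewrite pnatr_eq0; lia.
rewrite /hahn_excess divff // subrr !mul0r add0r mul1r mulr1.
by rewrite -addrA addrCA subrr addr0.
Qed.

(* For [t < r] the hypothesis [r * m <= t * (r + m - 1)] forces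
   [m <= (r - 1) ^ 2], so that each [r <= 5] leaves finitely many [m]. *)
Lemma hahn_step_le_hahn_excess_4_3 (k : nat) : (k <= 5)%N ->
  hahn_step 4 (4 + k%:R) 3 <= hahn_excess 4 (4 + k%:R) 3 :> R.
Proof.
move=> k5; rewrite -subr_ge0.
have k0 : 0 <= k%:R :> R by rewrite ler0n.
have k1 : k%:R <= 5 :> R by rewrite ler_nat.
move: (k%:R) k0 k1 => K k0 k1 {k5}.
have M0 : 0 < 4 + K by lra.
have M1 : 0 < 4 + K - 1 by lra.
have M2 : 0 < 4 + K - 2 by lra.
have M11 : 0 < 4 + K - 1 - 1 by lra.
have den : 0 < 4 * ((4 + K) ^+ 3 * (4 + K - 1) ^+ 2 * (4 + K - 2)).
  by rewrite !mulr_gt0 ?exprn_gt0 ?ltr0n.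
rewrite /hahn_step /hahn_bound /hahn_excess /hahn_var.
(* The negative coefficients are confined to the innermost factor, where [K <= 5] controls them. *)
apply: (@frac_ge0 _ (1152 + 1920 * K + K ^+ 2 *
  (1176 + K * (268 - 5 * K - 10 * K ^+ 2 - K ^+ 3))) _ den).
  by field; rewrite !gt_eqF.
have K2 : K ^+ 2 <= 5 * K by rewrite expr2 ler_wpM2r.
have K3 : K ^+ 3 <= 25 * K by have := ler_wpM2r k0 K2; rewrite -!exprSr; lra.
have h : 0 <= 1176 + K * (268 - 5 * K - 10 * K ^+ 2 - K ^+ 3).
  by have := mulr_ge0 k0 k0; nra.
by have := mulr_ge0 (sqr_ge0 K) h; lra.
Qed.

Lemma hahn_step_le_hahn_excess_5_4 (k : nat) : (k <= 11)%N ->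
  hahn_step 5 (5 + k%:R) 4 <= hahn_excess 5 (5 + k%:R) 4 :> R.
Proof.
move=> k11; rewrite -subr_ge0.
have k0 : 0 <= k%:R :> R by rewrite ler0n.
have k1 : k%:R <= 11 :> R by rewrite ler_nat.
move: (k%:R) k0 k1 => K k0 k1 {k11}.
have M0 : 0 < 5 + K by lra.
have M1 : 0 < 5 + K - 1 by lra.
have M2 : 0 < 5 + K - 2 by lra.
have M11 : 0 < 5 + K - 1 - 1 by lra.
have den : 0 < 5 * ((5 + K) ^+ 3 * (5 + K - 1) ^+ 2 * (5 + K - 2)).
  by rewrite !mulr_gt0 ?exprn_gt0 ?ltr0n.
rewrite /hahn_step /hahn_bound /hahn_excess /hahn_var.
apply: (@frac_ge0 _ (9600 + 13340 * K + K ^+ 2 *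
  (6859 + K * (1500 + 102 * K - 8 * K ^+ 2 - K ^+ 3))) _ den).
  by field; rewrite !gt_eqF.
have K2 : K ^+ 2 <= 11 * K by rewrite expr2 ler_wpM2r.
have K3 : K ^+ 3 <= 121 * K by have := ler_wpM2r k0 K2; rewrite -!exprSr; lra.
have h : 0 <= K * (1500 + 102 * K - 8 * K ^+ 2 - K ^+ 3).
  by apply: mulr_ge0 => //; lra.
have h' : 0 <= 6859 + K * (1500 + 102 * K - 8 * K ^+ 2 - K ^+ 3) by lra.
by have := mulr_ge0 (sqr_ge0 K) h'; lra.
Qed.

Lemma hahn_step_le_hahn_excess_5_3 (k : nat) : (k <= 1)%N ->
  hahn_step 5 (5 + k%:R) 3 <= hahn_excess 5 (5 + k%:R) 3 :> R.
Proof.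
move=> k1; rewrite -subr_ge0 /hahn_step /hahn_bound /hahn_excess /hahn_var.
case: k k1 => [|[|//]] _.
  by apply: (@frac_ge0 _ 2 25); rewrite ?ltr0n ?ler0n //; field.
by apply: (@frac_ge0 _ 1 200); rewrite ?ltr0n ?ler0n //; field.
Qed.

Lemma hahn_step_le_hahn_excess_3_2 : hahn_step 3 3 2 <= hahn_excess 3 3 2 :> R.
Proof.
rewrite -subr_ge0 /hahn_step /hahn_bound /hahn_excess /hahn_var.
by apply: (@frac_ge0 _ 0 1); rewrite ?ltr01 //; field.
Qed.

Lemma hahn_step_le_hahn_excess (r m t : nat) : (3 <= r <= m)%N -> (t < r)%N ->
  (r * m <= t * (r + m).-1)%N -> (r, m) != (3, 4) ->
  hahn_step r%:R m%:R t%:R <= hahn_excess r%:R m%:R t%:R :> R.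
Proof.
move=> /andP[r3 rm] tr cond rm34.
have [r6|r6] := leqP 6 r.
  apply: hahn_step_le_hahn_excess_large; rewrite ?ler0n ?ler_nat //.
  - exact: leq_trans rm.
  - exact: ltnW.
  - exact: leq_trans (ltnW tr) rm.
  - have -> : r%:R + m%:R - 1 = (r + m).-1%:R :> R.
      by rewrite -natrD -{1}[(r + m)%N]prednK ?predrS //; lia.
    by rewrite -!natrM ler_nat.
(* The hypothesis solved for [m]; with [r <= 5] and [r <= m] it leaves only [(3, 2)], [(4, 3)],
   [(5, 4)] and [(5, 3)] for [(r, t)]. *)
have tm : (m * (r - t) <= t * r.-1)%N by nia.
move: cond => _.
case: r r3 r6 tr rm rm34 tm => [|[|[|[|[|[|//]]]]]] // _ _ tr rm rm34 tm.
- have -> : t = 2 by case: t tr tm => [|[|[|]]] //; lia.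
  have -> : m = 3.
    by move: rm34 tr tm; rewrite xpair_eqE /=; case: t => [|[|[|]]] //; lia.
  exact: hahn_step_le_hahn_excess_3_2.
- have [tE m9] : t = 3 /\ (m - 4 <= 5)%N.
    by case: t tr tm => [|[|[|[|]]]] //; lia.
  by rewrite tE -(subnKC rm) natrD hahn_step_le_hahn_excess_4_3.
have [[tE m16]|[tE m6]] :
    (t = 4 /\ (m - 5 <= 11)%N) \/ (t = 3 /\ (m - 5 <= 1)%N).
  by case: t tr tm => [|[|[|[|[|]]]]] //; lia.
  by rewrite tE -(subnKC rm) natrD hahn_step_le_hahn_excess_5_4.
by rewrite tE -(subnKC rm) natrD hahn_step_le_hahn_excess_5_3.
Qed.

Lemma hahn_excess_bounds (r m t : nat) : (0 < r <= m)%N -> (t <= r)%N ->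
  (r * m <= t * (r + m).-1)%N -> 0 <= (hahn_excess r%:R m%:R t%:R : R) <= 1.
Proof.
move=> /andP[r0 rm] tr cond; have m0 := leq_trans r0 rm.
have /andP[_ x1] := ratio_natr r0 tr.
have /andP[_ y1] := ratio_natr m0 (leq_trans tr rm).
apply/andP; split; last by rewrite /hahn_excess lerBlDr lerD.
have frac (a b c : R) : a != 0 -> b != 0 ->
    c / a + c / b - 1 = (c * (a + b) - a * b) / (a * b).
  by move=> a0 b0; field; rewrite b0.
rewrite /hahn_excess frac ?pnatr_eq0 -?lt0n // -natrD -!natrM.
rewrite divr_ge0 ?ler0n // subr_ge0 ler_nat (leq_trans cond) //.
by rewrite leq_mul2l leq_pred orbT.
Qed.

Lemma hahn_le_hahn_excess (j r m t : nat) : (0 < j <= r)%N -> (r <= m)%N ->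
  (t <= r)%N -> (r * m <= t * (r + m).-1)%N ->
  hahn j r%:R m%:R t%:R <= hahn_excess r%:R m%:R t%:R :> R.
Proof.
move=> /andP[j0 jr] rm tr cond; have r0 := leq_trans j0 jr.
have m0 := leq_trans r0 rm.
have /andP[q0 q1] : 0 <= (hahn_excess r%:R m%:R t%:R : R) <= 1.
  by apply: hahn_excess_bounds; rewrite ?r0.
have [j1|j1] := eqVneq j 1%N.
  rewrite j1 hahn1 ?pnatr_eq0 -?lt0n //.
  by rewrite (le_trans _ q0) ?oppr_le0.
have [j2|j2] := eqVneq j 2%N.
  rewrite j2 in jr *.
  have v0 : 0 <= hahn_var r%:R m%:R t%:R :> R by rewrite hahn_var_ge0 ?jr.
  rewrite hahn2 ?subr_eq0 ?pnatr_eq0 ?pnatr_eq1 ?gtn_eqF ?(leq_trans jr) //.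
  by rewrite lerBlDr ler_wpDr // expr2 ler_piMl.
have j3 : (3 <= j)%N by lia.
move: tr; rewrite leq_eqVlt => /predU1P[->|tr].
  by apply: hahn_diag_le; rewrite ?jr ?andbT //; lia.
(* Here [t = 2] and [hahn_step] is [2/9], above [q = 1/6], so [hahn 3] is evaluated exactly. *)
have [[rE mE]|rm34] := eqVneq (r, m) (3, 4).
  rewrite rE mE in tr jr cond *.
  have -> : j = 3 by lia.
  have -> : t = 2 by lia.
  rewrite -subr_ge0 /hahn_excess /=.
  by apply: (@frac_ge0 _ 0 1); rewrite ?ltr01 //; field.
apply: le_trans (hahn_step_le_hahn_excess _ _ cond rm34) => //; last by lia.
apply: le_trans (ler_norm _) _.
case: j j0 jr j1 j2 j3 => // j _ jr _ _ j3.
apply: norm_hahnS_le; [lia | lia |] => t' tr'.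
by apply: norm_hahn_le; lia.
Qed.
End Hahn.

(** * Eigenfunctions on the blocks of a fixed size *)

Section Eberlein.
Variable R : realFieldType.

(* The factor ['C(m - h, m - t)] stands for ['C(m - h, t - h)], which would be
   wrong for [h > t] because of the truncated subtraction. *)
Definition eberlein (j r m t : nat) : R :=
  \sum_(h < j.+1) (-1) ^+ h *
    ('C(j, h) * ('C(r + h - j, t) * 'C(m - h, m - t)))%:R.

Lemma alternating_pascal (j : nat) (X : nat -> R) :
  \sum_(h < j.+2) (-1) ^+ h * ('C(j.+1, h))%:R * X h =
  \sum_(h < j.+1) (-1) ^+ h * ('C(j, h))%:R * (X h - X h.+1).
Proof.
rewrite big_ord_recl /= bin0.
under eq_bigr => i _ do rewrite /bump /= add1n binS natrD mulrDr mulrDl.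
rewrite big_split /= addrA big_ord_recr /= bin_small // mulr0 mul0r addr0.
under [in RHS]eq_bigr => i _ do rewrite mulrBr.
rewrite big_split /=; congr (_ + _).
  by rewrite [in RHS]big_ord_recl /= bin0.
by apply: eq_bigr => i _; rewrite exprS; ring.
Qed.

Lemma eberlein0 j r m : (j <= r)%N -> (j <= m)%N -> eberlein j r m 0 = 1.
Proof.
move=> jr jm; rewrite /eberlein big_ord_recl big1 => [|i _].
  by rewrite !bin0 !subn0 binn expr0 mul1r addr0.
have ij := ltn_ord i; rewrite lift0.
by rewrite [X in (_ * (_ * X))%N]bin_small ?muln0 ?mulr0 //; lia.
Qed.

Lemma eberlein_zero r m t : (t <= m)%N ->
  eberlein 0 r m t = ('C(r, t) * 'C(m, t))%:R.
Proof.
move=> tm; rewrite /eberlein big_ord1 addn0 !subn0 bin0 bin_sub //.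
by rewrite !mul1r mul1n.
Qed.

(** After [alternating_pascal], Pascal's rule in both binomial factors gives
    [a (b + b') - (a + a') b = a b' - a' b]. *)
Lemma eberleinS j r m t : (j <= r <= m)%N -> (t <= r)%N ->
  eberlein j.+1 r.+1 m.+1 t.+1 = eberlein j r m t.+1 - eberlein j r m t.
Proof.
move=> /andP[jr rm] tr; rewrite /eberlein.
under eq_bigr => h _ do rewrite natrM mulrA.
rewrite (alternating_pascal j
  (fun h => ('C(r.+1 + h - j.+1, t.+1) * 'C(m.+1 - h, m.+1 - t.+1))%:R)).
rewrite -sumrB; apply: eq_bigr => h _; rewrite -mulrBr -mulrA; congr (_ * _).
have hj := ltn_ord h; rewrite !natrM -mulrBr; congr (_ * _).
have -> : (r.+1 + h.+1 - j.+1 = (r + h - j).+1)%N by lia.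
have -> : (r.+1 + h - j.+1 = r + h - j)%N by lia.
rewrite binS natrD !subSS.
have -> : (m.+1 - h = (m - h).+1)%N by lia.
case: (ltngtP t m) => tm; last 2 first.
- by lia.
- have a0 : 'C(r + h - j, t.+1) = 0%N by rewrite bin_small //; lia.
  by rewrite -tm subnn !bin0 a0; ring.
have -> : (m - t = (m - t.+1).+1)%N by lia.
by rewrite binS natrD; ring.
Qed.

(** Dividing [eberleinS] by the two binomials gives [hahnS], because
    ['C(a, t) / 'C(a.+1, t.+1) = t.+1 / a.+1] and ['C(a, t.+1) / 'C(a.+1, t.+1)] is its complement
    to 1. *)
Lemma eberlein_hahn j r m t : (j <= r <= m)%N -> (t <= r)%N ->
  eberlein j r m t = ('C(r, t) * 'C(m, t))%:R * hahn j r%:R m%:R t%:R.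
Proof.
elim: j r m t => [|j IHj] r m t /andP[jr rm] tr.
  by rewrite eberlein_zero ?mulr1 // (leq_trans tr).
case: t tr => [|t] tr.
  rewrite eberlein0 ?(leq_trans jr) // !bin0 mul1r.
  case: r jr rm {tr} => // r jr; case: m => // m rm.
  rewrite !ltnS in jr rm.
  have := IHj r m 0; rewrite jr eberlein0 ?(leq_trans jr) // !bin0 mul1r.
  by move=> /(_ rm isT) H; rewrite hahnS !predrS mulr0n !mul0r -H; ring.
case: r jr rm tr => // r jr; case: m => // m rm tr; rewrite !ltnS in jr rm tr.
have cE a : (t <= a)%N ->
    ('C(a.+1, t.+1)%:R * (t.+1%:R / a.+1%:R) = 'C(a, t)%:R :> R) *
    ('C(a.+1, t.+1)%:R * (1 - t.+1%:R / a.+1%:R) = 'C(a, t.+1)%:R :> R).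
  move=> ta; have a0 : a.+1%:R != 0 :> R by rewrite pnatr_eq0.
  have E : 'C(a.+1, t.+1)%:R * (t.+1%:R / a.+1%:R) = 'C(a, t)%:R :> R.
    apply: (mulIf a0); rewrite mulrA divfK // -!natrM.
    by rewrite mulnC -mul_bin_diag mulnC.
  by split=> //; rewrite mulrBr E mulr1 binS natrD addrK.
rewrite eberleinS ?jr // hahnS !predrS mulrBr.
have [c1 c2] := cE r tr; have [c3 c4] := cE m (leq_trans tr rm).
have E (a b c d e : R) : a * b * (c * d * e) = (a * c) * (b * d) * e by ring.
rewrite natrM !E c1 c2 c3 c4; congr (_ - _); last first.
  by rewrite IHj ?jr // natrM.
(* For [t = r] the index [t.+1] is out of reach of [IHj], but both sides vanish. *)
move: tr; rewrite leq_eqVlt => /predU1P[->|tr]; last first.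
  by rewrite IHj ?jr // natrM.
rewrite bin_small // !mul0r /eberlein big1 // => h _.
have hj := ltn_ord h.
have -> : 'C(r + h - j, r.+1) = 0%N by rewrite bin_small //; lia.
by rewrite mul0n muln0 mulr0.
Qed.
End Eberlein.

(** * Harmonic functions on the subsets of a finite set *)

Section Sets.
Variables (T : finType) (R : realFieldType).
Implicit Types (B S v w : {set T}) (g f : {set T} -> R).

Lemma sum_insert_delete (F : {set T} -> T -> R) :
  \sum_(B : {set T}) \sum_(x | x \notin B) F B x =
    \sum_(S : {set T}) \sum_(x in S) F (S :\ x) x.
Proof.
rewrite (exchange_big_dep predT) //= [RHS](exchange_big_dep predT) //=.
apply: eq_bigr => x _.
rewrite (reindex_onto (fun S => S :\ x) (fun B => x |: B)) => [|B /= xB].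
  apply: eq_bigl => S; rewrite !inE eqxx /=; apply/eqP/idP => [<-|xS].
    by rewrite !inE eqxx.
  exact: setD1K.
exact: setU1K.
Qed.

(** The kernel of the down operator of the Boolean lattice, on all levels at once; the size is
    selected only in [lift_sum] and [shell_sum]. *)
Definition harmonic g := forall B, \sum_(x | x \notin B) g (x |: B) = 0.

Definition lift_sum j g v :=
  \sum_(S : {set T} | (S \subset v) && (#|S| == j)) g S.

Definition shell_sum j g v h :=
  \sum_(S : {set T} | (#|S| == j) && (#|S :\: v| == h)) g S.

Lemma lift_sumE j g v : lift_sum j g v = shell_sum j g v 0.
Proof.
by apply: eq_bigl => S; rewrite cards_eq0 setD_eq0 andbC.
Qed.

(* Double counting the pairs [(S :\ x, x)] with [x \in S] relates consecutive
   shells of a harmonic function. *)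
Lemma shell_sumS j g v h : harmonic g ->
  h.+1%:R * shell_sum j g v h.+1 = - (j - h)%:R * shell_sum j g v h.
Proof.
move=> harm; apply/eqP; rewrite mulNr -addr_eq0; apply/eqP.
pose P B := (#|B|.+1 == j) && (#|B :\: v| == h).
have : \sum_(B : {set T}) \sum_(x | x \notin B)
    (if P B then g (x |: B) else 0) = 0.
  by apply: big1 => B _; case: (P B); [exact: harm | rewrite big1].
rewrite sum_insert_delete => <-; rewrite /shell_sum !big_distrr /=.
rewrite [X in X + _]big_mkcond [X in _ + X]big_mkcond -big_split /=.
apply: eq_bigr => S _.
have D1 x : x \in S ->
    P (S :\ x) = (#|S| == j) && (#|S :\: v| == (x \notin v) + h)%N.
  move=> xS; rewrite /P (cardsD1 x S) xS; congr (_ && _).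
  rewrite (cardsD1 x (S :\: v)) !inE xS andbT eqn_add2l.
  congr (#|pred_of_set _| == _).
  by apply/setP => y; rewrite !inE andbCA.
under [RHS]eq_bigr => x xS do rewrite D1 // setD1K //.
have [Sj|] /= := eqVneq #|S| j; last first.
  by rewrite addr0 big1.
rewrite (bigID (mem v)) /=.
have cD : (#|S :&: v| + #|S :\: v| = j)%N by rewrite cardsID.
rewrite [X in _ = X + _](_ : _ = \sum_(x in S :&: v)
    (if #|S :\: v| == h then g S else 0)); last first.
  by apply: eq_big => [x|x /andP[_ ->]] //; rewrite !inE.
rewrite [X in _ = _ + X](_ : _ = \sum_(x in S :\: v)
    (if #|S :\: v| == h.+1 then g S else 0)); last first.
  by apply: eq_big => [x|x /andP[_ /negPf->]] //; rewrite !inE andbC.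
rewrite !sumr_const; have [h1|] := eqVneq #|S :\: v| h.+1.
  by rewrite h1 gtn_eqF //= mul0rn addr0 add0r mulr_natl.
have [h1 _|_ _] := eqVneq #|S :\: v| h; last by rewrite !mul0rn addr0.
by rewrite add0r mul0rn addr0 mulr_natl -h1 -cD addnK.
Qed.

(** The factors [-(j - i)/(i + 1)] of [shell_sumS], for [i < h], multiply to [(-1)^h 'C(j, h)]. *)
Lemma harmonic_shell_sum j g v h : harmonic g ->
  shell_sum j g v h = (-1) ^+ h * ('C(j, h))%:R * lift_sum j g v.
Proof.
move=> harm; elim: h => [|h IHh]; first by rewrite bin0 !mul1r lift_sumE.
have h0 : h.+1%:R != 0 :> R by rewrite pnatr_eq0.
apply: (mulfI h0); rewrite shell_sumS // IHh !mulrA; congr (_ * _).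
have : h.+1%:R * 'C(j, h.+1)%:R = (j - h)%:R * 'C(j, h)%:R :> R.
  by rewrite -!natrM mul_bin_left.
rewrite exprS; move: (h.+1%:R) ('C(j, h.+1)%:R) => a b E.
have -> : a * (-1 * (-1) ^+ h) * b = - (-1) ^+ h * (a * b) by ring.
by rewrite E; ring.
Qed.

(** Such a [w] is determined by the points it omits: [t] points of [v :\: S] and [m - t] points of
    [~: v :\: S], chosen freely. *)
Lemma card_superset_shell r m t v S :
  (#|T| = r + m)%N -> #|v| = r -> (t <= m)%N ->
  #|[set w : {set T} | [&& #|w| == r, #|v :\: w| == t & S \subset w]]|
  = ('C(r + #|S :\: v| - #|S|, t) * 'C(m - #|S :\: v|, m - t))%N.
Proof.
move=> cT cv tm.
pose X := [set A : {set T} | A \subset v :\: S & #|A| == t].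
pose Y := [set A : {set T} | A \subset ~: v :\: S & #|A| == (m - t)%N].
have cvS : #|v :\: S| = (r + #|S :\: v| - #|S|)%N.
  by have := cardsID v S; have := cardsID S v; rewrite setIC; lia.
have cvC : #|~: v| = m by have := cardsC v; lia.
have cvCS : #|~: v :\: S| = (m - #|S :\: v|)%N.
  have -> : #|S :\: v| = #|~: v :&: S| by rewrite setDE setIC.
  by have := cardsID S (~: v); lia.
rewrite -cvS -cvCS -!cards_draws -cardsX.
pose f (w : {set T}) := (v :\: w, ~: v :\: w).
rewrite -(@card_in_imset _ _ f); last first.
  move=> w1 w2 _ _ [/setP e1 /setP e2]; apply/setP => x.
  have := e1 x; have := e2 x; rewrite !inE.
  by case: (x \in v); case: (x \in w1); case: (x \in w2).
apply: eq_card => -[A B]; apply/imsetP/setXP.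
  case=> w; rewrite inE => /and3P[/eqP cw /eqP cvw Sw] [-> ->].
  rewrite !inE cvw eqxx !setDS //=; split=> //; apply/eqP.
  have := cardsID v w; have := cardsID w v; have := cardsID w (~: v).
  by rewrite (setIC v w) setIC -setDE; lia.
rewrite !inE => -[/andP[Av /eqP cA] /andP[Bv /eqP cB]].
have inA x : (x \in A) ==> (x \notin S) && (x \in v).
  by apply/implyP; move=> /(subsetP Av); rewrite inE.
have inB x : (x \in B) ==> (x \notin S) && (x \notin v).
  by apply/implyP; move=> /(subsetP Bv); rewrite !inE.
have vA : v :\: ~: (A :|: B) = A.
  apply/setP => x; rewrite !inE negbK.
  by move: (inA x) (inB x); do 4!case: (_ \in _).
have vB : ~: v :\: ~: (A :|: B) = B.
  apply/setP => x; rewrite !inE negbK.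
  by move: (inA x) (inB x); do 4!case: (_ \in _).
exists (~: (A :|: B)); last by rewrite /f vA vB.
rewrite inE vA cA eqxx /=; apply/andP; split; last first.
  apply/subsetP => x xS; rewrite !inE.
  by move: (inA x) (inB x); rewrite xS; do 2!case: (_ \in _).
have AB : #|A :&: B| = 0%N.
  apply: eq_card0 => x; rewrite inE; move: (inA x) (inB x).
  by do 4!case: (_ \in _).
by have := cardsC (A :|: B); have := cardsUI A B; lia.
Qed.

(** After exchanging the sums, the weight of [S] counts the sets [w] containing it and depends only
    on [#|S :\: v|]; each shell then contributes a multiple of [lift_sum j g v] by
    [harmonic_shell_sum]. *)
Lemma lift_sum_eigen j g r m t v : harmonic g -> (#|T| = r + m)%N ->
  #|v| = r -> (t <= m)%N ->
  \sum_(w : {set T} | (#|w| == r) && (#|v :\: w| == t)) lift_sum j g w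
  = eberlein R j r m t * lift_sum j g v.
Proof.
move=> harm cT cv tm; rewrite /lift_sum.
rewrite (exchange_big_dep (fun S : {set T} => #|S| == j)) /= => [|w S _ /andP[]//].
transitivity (\sum_(S : {set T} | #|S| == j)
   ('C(r + #|S :\: v| - j, t) * 'C(m - #|S :\: v|, m - t))%:R * g S).
  apply: eq_bigr => S /eqP cS.
  rewrite -cS -(card_superset_shell S cT cv tm) sumr_const mulr_natl cS.
  congr (_ *+ _); apply: eq_card => w.
  by rewrite !inE unfold_in eqxx andbT -andbA.
rewrite (partition_big (fun S => inord #|S :\: v| : 'I_j.+1) predT) //=.
rewrite /eberlein big_distrl; apply: eq_bigr => h _ /=.
rewrite -[\sum_(S | _ && _) g S]/(lift_sum j g v).
have perm (a b c d : R) : a * (b * c) * d = c * (a * b * d) by ring.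
rewrite natrM perm -harmonic_shell_sum // /shell_sum.
rewrite big_distrr /=; apply: eq_big => [S|S /andP[/eqP cS /eqP <-]].
  have [cS|//] := eqVneq #|S| j; rewrite /= -val_eqE /= inordK //.
  by rewrite ltnS -cS subset_leq_card // subsetDl.
by rewrite inordK // ltnS -cS subset_leq_card // subsetDl.
Qed.

(** Over an ordered field [z *m z^T = 0] forces [z = 0]. So the kernel of [A] meets the row space of
    [A^T] trivially, and their ranks add up to [p]. *)
Lemma row_kernel_decomposition p q (A : 'M[R]_(p, q)) (u : 'rV[R]_p) :
  exists a b, u = a + b *m A^T /\ a *m A = 0.
Proof.
have sq0 k (z : 'rV[R]_k) : z *m z^T = 0 -> z = 0.
  move=> /matrixP/(_ 0 0); rewrite !mxE => /eqP.
  rewrite psumr_eq0 => [/allP z0|i _].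
    apply/rowP => i; have := z0 i; rewrite mem_index_enum !mxE => /(_ isT).
    by rewrite mulf_eq0 orbb => /eqP.
  by rewrite mxE -expr2 sqr_ge0.
have cap0 : (kermx A :&: A^T <= (0 : 'M[R]_(p, p)))%MS.
  apply/rV_subP => z; rewrite sub_capmx => /andP[/sub_kermxP zA /submxP[w zE]].
  have -> : z = 0; last exact: sub0mx.
  by apply: sq0; rewrite {2}zE trmx_mul trmxK mulmxA zA mul0mx.
have full : (u <= kermx A + A^T)%MS.
  apply: submx_trans (submx1 _) _; rewrite sub1mx /row_full.
  have := mxrank_sum_cap (kermx A) A^T.
  by rewrite (eqP (_ : \rank (kermx A :&: A^T)%MS == 0%N)) ?mxrank_eq0 -?submx0 //
    addn0 mxrank_ker mxrank_tr subnK ?rank_leq_row // => ->.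
have [[a b] /= ->] := sub_addsmxP full.
exists (a *m kermx A), b; split=> //.
by rewrite -mulmxA mulmx_ker mulmx0.
Qed.

(** Apply [row_kernel_decomposition] to the incidence matrix of sets against sets with one point
    less: its row kernel consists of the harmonic functions, and its transpose is the up
    operator. *)
Lemma harmonic_decomposition f : exists g f', harmonic g /\
  forall v, f v = g v + \sum_(x in v) f' (v :\ x).
Proof.
pose N := #|{: {set T}}|.
pose A : 'M[R]_(N, N) := \matrix_(i, j)
  \sum_(x | x \notin (enum_val j : {set T})) (enum_val i == x |: enum_val j)%:R.
have [a [b [fE aA]]] := row_kernel_decomposition A (\row_i f (enum_val i)).
exists (fun v => a 0 (enum_rank v)), (fun v => b 0 (enum_rank v)); split=> [B|v].
  have := congr1 (fun M : 'rV_N => M 0 (enum_rank B)) aA; rewrite !mxE => aB0.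
  rewrite -[RHS]aB0.
  under [RHS]eq_bigr => i _ do rewrite mxE enum_rankK big_distrr.
  rewrite exchange_big /=; apply: eq_bigr => x xB.
  rewrite (bigD1 (enum_rank (x |: B))) //= enum_rankK eqxx mulr1.
  rewrite big1 ?addr0 // => i.
  by rewrite -(can_eq enum_valK) enum_rankK => /negPf->; rewrite mulr0.
have := congr1 (fun M : 'rV_N => M 0 (enum_rank v)) fE.
rewrite !mxE enum_rankK => ->.
congr (_ + _).
transitivity (\sum_(B : {set T}) \sum_(x | x \notin B)
    b 0 (enum_rank B) * (v == x |: B)%:R).
  rewrite (reindex_onto enum_rank enum_val) => [|i _]; last exact: enum_valK.
  rewrite big_mkcond /=; apply: eq_bigr => B _.
  by rewrite enum_rankK eqxx !mxE !enum_rankK big_distrr.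
rewrite (sum_insert_delete (fun B x => b 0 (enum_rank B) * (v == x |: B)%:R)).
rewrite (bigD1 v) //= [X in _ + X]big1 ?addr0 => [|S Sv].
  by apply: eq_bigr => x xv; rewrite setD1K // eqxx mulr1.
by apply: big1 => x xS; rewrite setD1K // eq_sym (negPf Sv) mulr0.
Qed.

Lemma lift_sum_shadow j g k v : #|v| = k.+1 -> (j <= k)%N ->
  \sum_(x in v) lift_sum j g (v :\ x) = (k.+1 - j)%:R * lift_sum j g v.
Proof.
move=> cv jk; rewrite /lift_sum.
rewrite (exchange_big_dep
  (fun S : {set T} => (S \subset v) && (#|S| == j))) /=; last first.
  by move=> x S xv /andP[Sv ->]; rewrite andbT (subset_trans Sv) ?subsetDl.
rewrite big_distrr; apply: eq_bigr => S /andP[Sv /eqP cS] /=.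
rewrite mulr_natl -cS -cv -(cardsDS Sv) -sumr_const; apply: eq_bigl => x.
by rewrite subsetD1 Sv eqxx andbT /= !inE andbC.
Qed.

Lemma lift_sum_full j g v : #|v| = j -> lift_sum j g v = g v.
Proof.
move=> cv; rewrite /lift_sum (bigD1 v) ?subxx ?cv //= big1 ?addr0 // => S.
by rewrite -andbA => /and3P[Sv /eqP cS]; rewrite eqEcard Sv cS cv leqnn.
Qed.

(** Split off the harmonic part of [f] as the top term and decompose the remaining [f'] on [k]-sets;
    by [lift_sum_shadow], going up one level only rescales each component. *)
Lemma lift_sum_decomposition k f : exists g : nat -> {set T} -> R,
  (forall j, harmonic (g j)) /\
  forall v, #|v| = k -> f v = \sum_(j < k.+1) lift_sum j (g j) v.
Proof.
elim: k f => [|k IHk] f.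
  have [g [f' [harm fE]]] := harmonic_decomposition f.
  exists (fun _ => g); split=> // v v0; rewrite big_ord1 lift_sum_full //.
  by rewrite fE (cards0_eq v0) big_set0 addr0.
have [g [f' [harm fE]]] := harmonic_decomposition f.
have [g' [harm' f'E]] := IHk f'.
exists (fun j => if j == k.+1 then g else fun S => (k.+1 - j)%:R * g' j S).
split=> [j|v cv].
  case: eqP => _ // B; rewrite -mulr_sumr -[RHS](mulr0 (k.+1 - j)%:R).
  by congr (_ * _); exact: harm'.
rewrite big_ord_recr /= eqxx lift_sum_full // fE addrC; congr (_ + _).
transitivity (\sum_(x in v) \sum_(j < k.+1) lift_sum j (g' j) (v :\ x)).
  apply: eq_bigr => x xv; apply: f'E.
  by have := cardsD1 x v; rewrite xv cv => -[].
rewrite exchange_big; apply: eq_bigr => j _ /=.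
have jk := ltn_ord j; rewrite (lift_sum_shadow _ cv) ?ltn_eqF // /lift_sum.
by rewrite big_distrr.
Qed.

End Sets.

(** * Modularity of regular graphs *)

Section Spectral.
Variable R : realFieldType.

(* Groups a sum by the values of [mu] without an enumeration of these values. *)
Lemma sumr_fibers_ge0 (I : finType) (C : eqType) (mu : I -> C) (Y : C -> I -> R) :
  (forall c, 0 <= \sum_(i | mu i == c) Y c i) -> 0 <= \sum_i Y (mu i) i.
Proof.
move=> Y0; pose rep c := [pick i | mu i == c].
have repK i j : rep (mu i) = rep (mu j) -> mu i = mu j.
  rewrite /rep; case: pickP => [k /eqP <-|/(_ i)]; last by rewrite eqxx.
  by case: pickP => [k' /eqP <- [->]|_].
rewrite (partition_big (fun i => rep (mu i)) predT) //=.
apply: sumr_ge0 => o _.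
have [i0 /eqP <-|no] := pickP (fun i => rep (mu i) == o);
  last by rewrite big_pred0.
rewrite (eq_big (fun i => mu i == mu i0) (Y (mu i0))) // => i.
  by apply/eqP/eqP => [/repK|->].
by move/eqP/repK->.
Qed.

(* Eigenfunctions for distinct eigenvalues are orthogonal, so the form is the sum
   over the distinct eigenvalues [c] of [c] times the squared norm of the sum of
   the eigenfunctions for [c]. *)
Lemma symmetric_kernel_le (V I : finType) (b : V -> V -> R) (F : I -> V -> R)
    (mu : I -> R) (lam : R) (f : V -> R) :
  (forall v w, b v w = b w v) ->
  (forall i v, \sum_w b v w * F i w = mu i * F i v) ->
  (forall i, mu i <= lam) ->
  (forall v, f v = \sum_i F i v) ->
  \sum_v \sum_w b v w * (f v * f w) <= lam * \sum_v f v ^+ 2.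
Proof.
move=> bC eig mule fE.
pose ip i j := \sum_v F i v * F j v.
have orth i j : mu i != mu j -> ip i j = 0.
  rewrite -subr_eq0 => /mulfI; apply; rewrite mulr0 mulrBl; apply/eqP.
  rewrite subr_eq0 /ip !mulr_sumr; apply/eqP.
  transitivity (\sum_v \sum_w b v w * F i w * F j v).
    by apply: eq_bigr => v _; rewrite mulrA -eig mulr_suml.
  rewrite exchange_big; apply: eq_bigr => w _ /=.
  rewrite mulrCA -eig mulr_sumr; apply: eq_bigr => v _.
  by rewrite bC mulrA (mulrC (F i w)).
rewrite -subr_ge0.
have -> : lam * (\sum_v f v ^+ 2) - \sum_v \sum_w b v w * (f v * f w)
    = \sum_j \sum_i (lam - mu j) * ip i j.
  transitivity (\sum_v (lam * f v ^+ 2 - f v * \sum_j mu j * F j v)).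
    rewrite sumrB mulr_sumr; congr (_ - _); apply: eq_bigr => v _.
    under [in RHS]eq_bigr => j _ do rewrite -eig.
    rewrite exchange_big mulr_sumr; apply: eq_bigr => w _ /=.
    by rewrite -mulr_sumr -fE mulrCA.
  transitivity (\sum_v \sum_j (lam - mu j) * (f v * F j v)).
    apply: eq_bigr => v _.
    rewrite expr2 {2}fE mulrCA -mulrBr mulr_sumr -sumrB mulr_sumr.
    by apply: eq_bigr => j _; rewrite -mulrBl mulrCA.
  rewrite exchange_big; apply: eq_bigr => j _ /=.
  rewrite -!mulr_sumr; congr (_ * _).
  rewrite exchange_big; apply: eq_bigr => v _ /=.
  by rewrite fE mulr_suml.
pose Y c j := (lam - c) * \sum_(i | mu i == c) ip i j.
have -> : \sum_j \sum_i (lam - mu j) * ip i j = \sum_j Y (mu j) j.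
  apply: eq_bigr => j _; rewrite /Y -mulr_sumr; congr (_ * _).
  rewrite [RHS]big_mkcond; apply: eq_bigr => i _.
  by case: eqP => // /eqP /orth.
apply: sumr_fibers_ge0 => c; rewrite /Y -mulr_sumr.
have [i0 /eqP <-|no] := pickP (fun i => mu i == c);
  last by rewrite big_pred0 // mulr0.
apply: mulr_ge0; first by rewrite subr_ge0.
have -> : \sum_(j | mu j == mu i0) \sum_(i | mu i == mu i0) ip i j
   = \sum_v (\sum_(i | mu i == mu i0) F i v) ^+ 2.
  rewrite exchange_big /= ; under [in LHS]eq_bigr => i _ do rewrite exchange_big.
  rewrite exchange_big; apply: eq_bigr => v _ /=.
  by rewrite expr2 mulr_suml; apply: eq_bigr => i _; rewrite mulr_sumr.
by apply: sumr_ge0 => v _; exact: sqr_ge0.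
Qed.

Lemma regular_kernel_le (V I : finType) (a : V -> V -> R) (F : I -> V -> R)
    (mu : I -> R) (lam d : R) (f : V -> R) :
  (0 < #|V|)%N -> lam <= d ->
  (forall v w, a v w = a w v) -> (forall v, \sum_w a v w = d) ->
  (forall i v, \sum_w a v w * F i w = mu i * F i v) ->
  (forall i, mu i <= lam \/ mu i = d /\ exists c, forall v, F i v = c) ->
  (forall v, f v = \sum_i F i v) ->
  \sum_v \sum_w a v w * (f v * f w)
    <= lam * \sum_v f v ^+ 2 + (d - lam) / #|V|%:R * (\sum_v f v) ^+ 2.
Proof.
move=> V0 lamd aC deg eig mu_le fE.
have N0 : #|V|%:R != 0 :> R by rewrite pnatr_eq0 -lt0n.
(* Deflation: the constants become eigenfunctions for [lam]. *)
pose b v w := a v w - (d - lam) / #|V|%:R.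
have bE (h : V -> R) v : \sum_w b v w * h w
    = \sum_w a v w * h w - (d - lam) / #|V|%:R * \sum_w h w.
  by rewrite mulr_sumr -sumrB; apply: eq_bigr => w _; rewrite mulrBl.
(* Columns also sum to [d] by symmetry, so an eigenfunction for another eigenvalue has sum 0 and is
   unaffected by the deflation. *)
have sum0 i : (mu i - d) * \sum_v F i v = 0.
  apply/eqP; rewrite mulrBl subr_eq0 !mulr_sumr; apply/eqP.
  transitivity (\sum_v \sum_w a v w * F i w).
    by apply: eq_bigr => v _; rewrite eig.
  rewrite exchange_big; apply: eq_bigr => w _ /=.
  by rewrite -mulr_suml -(deg w); congr (_ * _); apply: eq_bigr => v _.
have : \sum_v \sum_w b v w * (f v * f w) <= lam * \sum_v f v ^+ 2.
  (* [Num.min] keeps the eigenvalues up to [lam] and replaces [d] by [lam]. *)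
  apply: (@symmetric_kernel_le _ _ b F (fun i => Num.min (mu i) lam)) => //.
  - by move=> v w; rewrite /b aC.
  - move=> i v; rewrite bE eig.
    have [muc|] := leP (mu i) lam.
      have [mud|mud] := eqVneq (mu i) d.
        have -> : lam = d by apply/le_anti; rewrite lamd -mud.
        by rewrite subrr !mul0r subr0.
      have -> : \sum_w F i w = 0.
        by move/eqP: (sum0 i); rewrite mulf_eq0 subr_eq0 (negPf mud) => /eqP.
      by rewrite mulr0 subr0.
    move=> lt_mu; have [|[-> [c Fc]]] := mu_le i; first by rewrite leNgt lt_mu.
    under eq_bigr do rewrite Fc.
    by rewrite Fc sumr_const -[c *+ _]mulr_natr; field.
  - by move=> i; rewrite ge_min lexx orbT.
rewrite -lerBlDr; congr (_ <= _).
rewrite expr2 mulr_suml mulr_sumr -sumrB; apply: eq_bigr => v _.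
have pull (k : V -> V -> R) :
    \sum_w k v w * (f v * f w) = f v * \sum_w k v w * f w.
  by rewrite mulr_sumr; apply: eq_bigr => w _; rewrite mulrCA.
by rewrite !pull bE mulrBr; congr (_ - _); rewrite mulrCA.
Qed.
End Spectral.

(** * From a quadratic form bound to modularity *)

Section Modularity.
Variables (T : finType) (e : rel T).
Hypotheses (e_sym : symmetric e) (e_irr : irreflexive e).

Lemma double_num_edges_in (A : {set T}) :
  (num_edges_in e A * 2 = \sum_(v in A) \sum_(w in A) e v w)%N.
Proof.
pose PA := [set p : T * T | [&& p.1 \in A, p.2 \in A & e p.1 p.2]].
pose phi (p : T * T) := [set p.1; p.2].
have -> : (\sum_(v in A) \sum_(w in A) e v w = #|PA|)%N.
  rewrite pair_big_dep /= -sum1_card big_mkcond [RHS]big_mkcond.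
  apply: eq_bigr => -[x y] _; rewrite inE /=.
  by case: (x \in A); case: (y \in A); case: (e x y).
rewrite -sum1_card.
rewrite (partition_big phi (mem [set E in edges e | E \subset A])) /=; last first.
  move=> [x y]; rewrite !inE /= => /and3P[xA yA xy].
  rewrite subUset !sub1set xA yA !andbT.
  by apply/imsetP; exists (x, y); rewrite ?inE.
rewrite /num_edges_in -sum_nat_const; apply: eq_bigr => E.
rewrite inE => /andP[/imsetP[[x y] /= xy ->]].
rewrite subUset !sub1set => /andP[xA yA].
have nxy : x != y by apply: contraTneq xy => ->; rewrite inE /= e_irr.
rewrite inE /= in xy.
have -> : \sum_(p in PA | phi p == [set x; y]) 1 = #|[set (x, y); (y, x)]|.
  rewrite sum1_card; apply: eq_card => -[x' y'].
  rewrite !inE /= /phi !xpair_eqE /=; apply/andP/orP.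
    case=> _ /eqP /= E2.
    have : x' \in [set x; y] by rewrite -E2 !inE eqxx.
    have : y' \in [set x; y] by rewrite -E2 !inE eqxx orbT.
    have : y \in [set x'; y'] by rewrite E2 !inE eqxx orbT.
    have : x \in [set x'; y'] by rewrite E2 !inE eqxx.
    rewrite !inE (eq_sym x) (eq_sym x) (eq_sym y) (eq_sym y).
    by case: (x' == x); case: (y' == y); case: (x' == y); case: (y' == x) => //=;
      auto.
  rewrite /PA inE /=.
  case=> /andP[/eqP-> /eqP->]; first by rewrite xA yA xy.
  by rewrite xA yA e_sym xy setUC.
by rewrite cards2 xpair_eqE negb_and nxy.
Qed.

(** With [N = #|T|] and [a = #|A|], the bound on the form makes the contribution of [A] at most
    [lam a / (d N) - lam a^2 / (d N^2)]. Dropping the last term and summing over the partition,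
    where the [a] add up to [N], gives [lam / d]. *)
Lemma modularity_regular_le (d : nat) (lam : rat) :
  (0 < num_edges e)%N -> (forall v, degree e v = d) -> 0 <= lam ->
  (forall A : {set T}, (\sum_(v in A) \sum_(w in A) e v w)%N%:R <=
     lam * #|A|%:R + (d%:R - lam) / #|T|%:R * #|A|%:R ^+ 2) ->
  modularity e <= lam / d%:R.
Proof.
move=> e0 deg lam0 quad.
have [P /and3P[/eqP cP tP _] ->] := modularity_attained e0.
have m2 : (num_edges e * 2 = #|T| * d)%N.
  have -> : num_edges e = num_edges_in e setT.
    by congr #|pred_of_set _|; apply/setP => E; rewrite !inE subsetT andbT.
  rewrite double_num_edges_in -sum_nat_const.
  apply: eq_big => [v|v _]; rewrite ?inE //.
  rewrite -(deg v) /degree -sum1_card [RHS]big_mkcond /=.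
  by apply: eq_big => [w|w _]; rewrite !inE //; case: (e v w).
have T0 : #|T|%:R != 0 :> rat.
  by rewrite pnatr_eq0; apply: contraTneq e0 => z; move: m2; rewrite z; lia.
have d0 : d%:R != 0 :> rat.
  by rewrite pnatr_eq0; apply: contraTneq e0 => z; move: m2; rewrite z; lia.
have mE : (num_edges e)%:R = #|T|%:R * d%:R / 2 :> rat.
  by rewrite -natrM -m2 natrM mulfK.
have sumP : \sum_(A in P) #|A|%:R = #|T|%:R :> rat.
  by rewrite -natr_sum -cardsT -cP; congr (_%:R); exact: (eqP tP).
rewrite /partition_modularity -sumrB.
apply: le_trans (_ : \sum_(A in P) lam / (d%:R * #|T|%:R) * #|A|%:R <= _);
  last first.
  by rewrite -mulr_sumr sumP invfM mulrA divfK.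
apply: ler_sum => A _.
have -> : (\sum_(v in A) degree e v)%N = (#|A| * d)%N.
  by rewrite -sum_nat_const; apply: eq_bigr.
have h := quad A; rewrite -double_num_edges_in natrM in h.
have -> : (num_edges_in e A)%:R = (num_edges_in e A)%:R * 2 / 2 :> rat.
  by rewrite mulfK.
move: ((num_edges_in e A)%:R * 2) h => X h.
rewrite mE natrM.
have dge0 : 0 < d%:R :> rat by rewrite lt0r d0 ler0n.
have Tge0 : 0 < #|T|%:R :> rat by rewrite lt0r T0 ler0n.
have age0 : 0 <= #|A|%:R :> rat by rewrite ler0n.
move: (#|A|%:R) (#|T|%:R) (d%:R) T0 d0 (ltW dge0) (ltW Tge0) age0 h.
move=> a N D N0 D0 Dge Nge age h.
rewrite -subr_ge0.
have -> : lam / (D * N) * a -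
    (X / 2 / (N * D / 2) - (a * D) ^+ 2 / (4 * (N * D / 2) ^+ 2))
  = (lam * a + (D - lam) / N * a ^+ 2 - X) / (N * D)
    + lam * a ^+ 2 / (N ^+ 2 * D).
  by field; rewrite D0 N0.
by rewrite addr_ge0 // divr_ge0 ?subr_ge0 ?mulr_ge0.
Qed.
End Modularity.

(** * Johnson graphs *)

Section Kernel.
Variables (R : realFieldType) (T V : finType) (S : V -> {set T}) (k m t : nat).
Hypotheses (k_gt0 : (0 < k)%N) (km : (k <= m)%N) (tk : (t <= k)%N).
Hypotheses (cardT : #|T| = (k + m)%N) (S_inj : injective S).
Hypothesis S_image : forall A, (A \in [set S v | v : V]) = (#|A| == k).

Let card_S v : #|S v| = k.
Proof. by apply/eqP; rewrite -S_image imset_f. Qed.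

Let a v w := (#|S v :\: S w| == t)%:R : R.

Lemma sum_shell (G : {set T} -> R) v : \sum_w a v w * G (S w) =
  \sum_(A : {set T} | (#|A| == k) && (#|S v :\: A| == t)) G A.
Proof.
transitivity (\sum_(A in [set S w | w : V]) (#|S v :\: A| == t)%:R * G A).
  by rewrite big_imset //= => w1 w2 _ _ /S_inj.
rewrite big_mkcond [RHS]big_mkcond; apply: eq_bigr => A _; rewrite S_image.
by case: eqP => //= _; case: eqP; rewrite ?mul1r ?mul0r.
Qed.

Lemma sum_shell_lift_sum j (g : {set T} -> R) v : harmonic g ->
  \sum_w a v w * lift_sum j g (S w) = eberlein R j k m t * lift_sum j g (S v).
Proof.
by move=> harm; rewrite sum_shell (lift_sum_eigen _ harm cardT) ?(leq_trans tk).
Qed.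

Lemma lift_sum0 (g : {set T} -> R) v : lift_sum 0 g v = g set0.
Proof.
rewrite /lift_sum (bigD1 set0) ?sub0set ?cards0 //= big1 ?addr0 // => A.
by rewrite cards_eq0 -andbA => /and3P[_ /eqP->]; rewrite eqxx.
Qed.

(** The indicator of the empty set is harmonic, and its lift for [j = 0] is the constant 1, so the
    row sum is the eigenvalue [eberlein 0]. *)
Lemma shell_degree v : \sum_w a v w = ('C(k, t) * 'C(m, t))%:R.
Proof.
pose g (A : {set T}) : R := (A == set0)%:R.
have harm : harmonic g.
  move=> B; apply: big1 => x _; rewrite /g; case: eqP => // /setP/(_ x).
  by rewrite !inE eqxx.
have := sum_shell_lift_sum 0 v harm; rewrite eberlein_zero ?(leq_trans tk) //.
rewrite lift_sum0 /g eqxx mulr1 => <-; apply: eq_bigr => w _.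
by rewrite lift_sum0 eqxx mulr1.
Qed.

Hypothesis V_gt0 : (0 < #|V|)%N.
Hypothesis cond : (k * m <= t * (k + m).-1)%N.

Lemma shell_kernel_le (f : V -> R) (d lam : R) :
  d = ('C(k, t) * 'C(m, t))%:R -> lam = d * hahn_excess k%:R m%:R t%:R ->
  \sum_v \sum_w a v w * (f v * f w)
    <= lam * \sum_v f v ^+ 2 + (d - lam) / #|V|%:R * (\sum_v f v) ^+ 2.
Proof.
move=> defd deflam.
have /andP[q0 q1] : 0 <= (hahn_excess k%:R m%:R t%:R : R) <= 1.
  by apply: hahn_excess_bounds; rewrite ?k_gt0.
(* Transports [f] to all subsets of [T], with value 0 off the image of [S]. *)
pose f' A := \sum_w (S w == A)%:R * f w.
have f'S v : f' (S v) = f v.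
  rewrite /f' (bigD1 v) //= eqxx mul1r big1 ?addr0 // => w wv.
  by rewrite (inj_eq S_inj) (negPf wv) mul0r.
have [g [harm gE]] := lift_sum_decomposition k f'.
have d0 : 0 <= d by rewrite defd ler0n.
apply: (@regular_kernel_le _ _ 'I_k.+1 a
  (fun j v => lift_sum j (g j) (S v)) (fun j => eberlein R j k m t)).
- exact: V_gt0.
- by rewrite deflam ler_piMr.
- move=> v w; rewrite /a; congr (_ == _)%:R.
  apply/eqP; rewrite -(eqn_add2l #|S v :&: S w|) cardsID setIC cardsID.
  by rewrite !card_S.
- by move=> v; rewrite defd shell_degree.
- by move=> j v; apply: sum_shell_lift_sum.
- move=> j; have [j0|j0] := posnP j.
    right; rewrite j0 defd eberlein_zero ?(leq_trans tk) //; split=> //.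
    by exists (g 0%N set0) => v; rewrite lift_sum0.
  left; have jk : (j <= k)%N by rewrite -ltnS.
  rewrite deflam defd eberlein_hahn ?jk // ler_wpM2l //.
  by apply: hahn_le_hahn_excess; rewrite ?j0.
- by move=> v; rewrite -f'S gE.
Qed.
End Kernel.

(** * Vertices as sets, and the final bound *)

Section Johnson.
Variables n r s : nat.
Local Notation V := (johnson_vertex n r).
Implicit Types v w : V.

Definition ones v : {set 'I_n} := [set i | val v i].

Lemma ones_inj : injective ones.
Proof.
move=> v w /setP vw; apply/val_inj/ffunP => i.
by have := vw i; rewrite !inE.
Qed.

Lemma sum_bool (f : 'I_n -> bool) : (\sum_i f i)%N = #|[set i | f i]|.
Proof.
rewrite -sum1_card big_mkcond [RHS]big_mkcond; apply: eq_bigr => i _.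
by rewrite inE; case: (f i).
Qed.

Lemma card_ones v : #|ones v| = r.
Proof. by rewrite -sum_bool (eqP (valP v)). Qed.

Lemma ones_image A : (A \in [set ones v | v : V]) = (#|A| == r).
Proof.
apply/imsetP/eqP => [[v _ ->]|cA]; first exact: card_ones.
have vP : (\sum_(i < n) [ffun i => i \in A] i)%N == r.
  by rewrite sum_bool -cA; apply/eqP/eq_card => i; rewrite inE ffunE.
exists (Sub [ffun i => i \in A] vP) => //.
by apply/setP => i; rewrite inE SubK ffunE.
Qed.

Lemma johnsonE v w : (s <= r)%N ->
  johnson s v w = (#|ones v :\: ones w| == (r - s)%N).
Proof.
move=> sr; rewrite /johnson.
have -> : inner_product (val v) (val w) = #|ones v :&: ones w|.
  rewrite /inner_product; under eq_bigr do rewrite mulnb.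
  by rewrite sum_bool; apply: eq_card => i; rewrite !inE.
by have := cardsID (ones w) (ones v); rewrite card_ones; lia.
Qed.

(* Complementing makes the blocks at most half of the ground set; it preserves
   the relation [#|A :\: B| = t] between sets of equal size. *)
Definition short_side v := if (r <= n - r)%N then ones v else ~: ones v.

Lemma short_side_inj : injective short_side.
Proof.
by rewrite /short_side => v w; case: ifP => _ => [/ones_inj|/setC_inj/ones_inj].
Qed.

Lemma short_side_image A : (r <= n)%N ->
  (A \in [set short_side v | v : V]) = (#|A| == minn r (n - r)).
Proof.
move=> rn; rewrite /short_side; case: (leqP r (n - r)) => rn1.
  exact: ones_image.
apply/imsetP/eqP => [[v _ ->]|cA].
  by have := cardsC (ones v); rewrite card_ones card_ord; lia.
have : ~: A \in [set ones v | v : V].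
  by rewrite ones_image; have := cardsC A; rewrite cA card_ord; lia.
by case/imsetP => v _ E; exists v; rewrite // -E setCK.
Qed.

Lemma johnson_short_side v w : (s <= r)%N ->
  johnson s v w = (#|short_side v :\: short_side w| == (r - s)%N).
Proof.
move=> sr; rewrite johnsonE // /short_side; case: ifP => // _.
have -> : ~: ones v :\: ~: ones w = ones w :\: ones v.
  by rewrite !setDE setCK setIC.
have := cardsID (ones w) (ones v); have := cardsID (ones v) (ones w).
by rewrite !card_ones setIC => /esym -> /eqP; rewrite eqn_add2l => /eqP->.
Qed.
End Johnson.

Theorem corollary3p1p2 (n r s : nat) (lt_sr : (s < r)%N) (lt_rn : (r < n)%N)
    (has_edge : (1 <= num_edges (@johnson n r s))%N)
    (hnrs : (r%:R - s%:R) * (n%:R - 1) >= r%:R * (n%:R - r%:R) :> rat) :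
  modularity (@johnson n r s)
    <= `|s%:R * n%:R - r%:R ^+ 2| / (r%:R * (n%:R - r%:R)).
Proof.
pose k := minn r (n - r); pose m := maxn r (n - r); pose t := (r - s)%N.
have sr := ltnW lt_sr; have rn := ltnW lt_rn.
have k0 : (0 < k)%N by rewrite /k; lia.
have km : (k <= m)%N by rewrite /k /m; lia.
have cT : #|'I_n| = (k + m)%N by rewrite card_ord /k /m; lia.
have [v [w vw]] : exists v w, johnson s v w (n := n) (r := r).
  case/card_gt0P: (has_edge) => E /imsetP[[x y]]; rewrite inE => xy _.
  by exists x, y.
have cS (u : johnson_vertex n r) : #|short_side u| = k.
  by apply/eqP; rewrite -short_side_image // imset_f.
(* An edge exhibits two blocks of size [k] whose difference has [t] elements. *)
have tk : (t <= k)%N.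
  move: vw; rewrite johnson_short_side // => /eqP; rewrite -/t => <-.
  by rewrite -(cS v) subset_leq_card // subsetDl.
have cond : (k * m <= t * (k + m).-1)%N.
  have n1 : n%:R - 1 = n.-1%:R :> rat by rewrite -{1}(ltn_predK lt_rn) predrS.
  move: hnrs; rewrite n1 -!natrB //.
  rewrite -!natrM ler_nat; have -> : (k * m = r * (n - r))%N.
    by rewrite /k /m; case: (leqP r (n - r)); nia.
  by have -> : (k + m = n)%N by rewrite /k /m; lia.
have V0 : (0 < #|{: johnson_vertex n r}|)%N by apply/card_gt0P; exists v.
pose d := ('C(k, t) * 'C(m, t))%N.
have d0 : d%:R != 0 :> rat.
  by rewrite pnatr_eq0 -lt0n muln_gt0 !bin_gt0 tk (leq_trans tk).
have im A : (A \in [set short_side u | u : johnson_vertex n r]) = (#|A| == k).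
  exact: short_side_image.
pose q : rat := hahn_excess k%:R m%:R t%:R.
have /andP[q0 _] : 0 <= q <= 1 by apply: hahn_excess_bounds; rewrite ?k0.
have -> : `|s%:R * n%:R - r%:R ^+ 2| / (r%:R * (n%:R - r%:R)) = q.
  have qE : q = hahn_excess r%:R (n%:R - r%:R) t%:R.
    rewrite -natrB // /q /k /m; case: (leqP r (n - r)) => // _.
    by rewrite /hahn_excess (addrC (_ / _)).
  have r0 : r%:R != 0 :> rat by rewrite pnatr_eq0; lia.
  have nr0 : 0 < n%:R - r%:R :> rat by rewrite subr_gt0 ltr_nat.
  have den0 : 0 <= (r%:R * (n%:R - r%:R))^-1 :> rat.
    by rewrite invr_ge0 mulr_ge0 ?ler0n // ltW.
  rewrite -(ger0_norm den0) -normrM.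
  (* The quantity inside the absolute value is [-q] and [q >= 0], so the norm flips its sign. *)
  have -> : (s%:R * n%:R - r%:R ^+ 2) / (r%:R * (n%:R - r%:R)) = - q.
    by rewrite qE /hahn_excess /t natrB //; field; rewrite r0 gt_eqF.
  by rewrite normrN ger0_norm.
rewrite -[q](mulKf d0) [_^-1 * _]mulrC; apply: modularity_regular_le => //.
- exact: johnson_sym.
- exact: johnson_irrefl.
- move=> u; apply/eqP; rewrite -(eqr_nat rat).
  rewrite -(shell_degree rat km tk cT (@short_side_inj n r) im u).
  rewrite /degree -sum1_card natr_sum big_mkcond; apply/eqP/eq_bigr => u' _.
  by rewrite inE johnson_short_side //; case: eqP.
- by rewrite mulr_ge0.
move=> A.
(* For the indicator of [A], the sums of [f] and of [f ^+ 2] are both [#|A|]. *)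
have := shell_kernel_le k0 km tk cT (@short_side_inj n r) im V0 cond
  (fun u => (u \in A)%:R) erefl (erefl (d%:R * q)).
have -> : \sum_u (u \in A)%:R ^+ 2 = #|A|%:R :> rat.
  rewrite -sum1_card natr_sum [RHS]big_mkcond; apply: eq_bigr => u _.
  by case: (u \in A); rewrite ?expr1n ?expr0n.
have -> : \sum_u (u \in A)%:R = #|A|%:R :> rat.
  rewrite -sum1_card natr_sum [RHS]big_mkcond; apply: eq_bigr => u _.
  by case: (u \in A).
move=> h; apply: le_trans h; rewrite le_eqVlt; apply/orP; left; apply/eqP.
rewrite natr_sum big_mkcond; apply: eq_bigr => u _.
have [uA|uA] := boolP (u \in A); last first.
  by rewrite big1 // => u' _; rewrite mul0r mulr0.
rewrite natr_sum big_mkcond; apply: eq_bigr => u' _.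
rewrite mul1r johnson_short_side //.
by case: (u' \in A); rewrite ?mulr1 ?mulr0.
Qed.
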